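(* Let $M>0$ and let $F(z)=\overline{z}A(z)+B(z)$ be a bi-analytic function on $U$, where $A$ and $B$ are analytic on $U$ with $A(0)=B(0)=0$, $A'(0)=B'(0)=1$, and $|A|$ and $|B|$ are both bounded by $M$ on $U$. Then there is a constant $\rho_1$ with $0<\rho_1<1$ such that $F$ is univalent in $|z|<\rho_1$; specifically, $\rho_1$ satisfies $$1-2M\left(\frac{2\rho_1-\rho_1^2}{(1-\rho_1)^2}\right)=0,$$ that is, $$\rho_1=\frac{2M}{2M+1}\left(1-\sqrt{\frac{2M+1}{2M}}+\frac{1}{2M}\right).$$ Moreover, $F(U_{\rho_1})$ contains the disk $U_{R_1}$, where $$R_1=\rho_1-\rho_1^2-M\,\frac{\rho_1^3+\rho_1^2}{1-\rho_1}.$$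
   Context: $U=\{z\in\mathbb{C}:|z|<1\}$ is the open unit disk and $U_\rho=\{z\in\mathbb{C}:|z|<\rho\}$. A bi-analytic function on $U$ is a function of the form $F(z)=\overline z A(z)+B(z)$ with $A,B$ analytic on $U$ (equivalently $\partial_{\overline z}^2F=0$). Univalent means injective. *)

(* Defs.v *)
From Stdlib Require Import Reals.
From Coquelicot Require Import Coquelicot.
Local Open Scope R_scope.

Definition disk (r : R) (z : C) : Prop := Cmod z < r.

(* Complex differentiability at every point of an open set [D]; the scalar
   field is [C], not [R].  Functions are total, but since [D] is open only
   their values on [D] matter. *)
Definition analytic_on (D : C -> Prop) (f : C -> C) : Prop :=
  forall z : C, D z -> ex_derive (K := C_AbsRing) (V := C_NormedModule) f z.

Definition univalent_on (D : C -> Prop) (f : C -> C) : Prop :=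
  forall z1 z2 : C, D z1 -> D z2 -> f z1 = f z2 -> z1 = z2.

Definition image (f : C -> C) (D : C -> Prop) (w : C) : Prop :=
  exists z : C, D z /\ f z = w.

(* Main.v *)
(* Put [G z = F z - z].  For |z| < R < 1 the Cauchy formula on |zeta| = R, with
   f(0) = 0 and f'(0) = 1, gives
     f(z) = (1/2pi) int f(zeta) z/(zeta - z) dt,   1 = (1/2pi) int f(zeta)/zeta dt
   for f = A and f = B, so differences of [B z - z] and of [conj z * A z] are
   controlled by differences of explicit kernels.  Letting R tend to 1, [G] has on
   |z| <= r the Lipschitz constant [2 M (2 r - r^2) / (1 - r)^2], which is below 1
   exactly when r < rho1; hence [F] is injective.  On |z| <= rho1 also
   [|G z| <= rho1 - R1], so for |w| < R1 the map [z |-> w - G z] is a contraction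
   of a disk of radius less than rho1 and its fixed point solves [F z = w].

   The Cauchy formula for functions that are merely complex differentiable rests
   on Goursat's theorem for triangles, applied to [(f w - f z) / (w - z)], which
   is continuous at its exceptional point z. *)
Require Import Defs.
From Stdlib Require Import Reals Lra Lia Psatz IndefiniteDescription Classical.
From Coquelicot Require Import Coquelicot.
Local Open Scope R_scope.

(** * Continuity, differentiability and geometric convergence in [C] *)

(** The constants are those of coefficient estimates: if the Taylor coefficients are at most [M],
    then [B z - z] and [conj z * A z] each have the Lipschitz majorant [M] times the sum of n
    r^(n-1) over n >= 2, which is M (2 r - r^2) / (1 - r)^2. Factoring [z1 - z2] out of the
    differences of Cauchy kernels yields the same sums in closed form, so no power series is
    developed. For [B], subtracting [z1 - z2] times the mean of f(zeta)/zeta removes the linear part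
    of the kernel; this is what makes the constant small for small r. *)

Notation CR := C_R_CompleteNormedModule.

(* Coquelicot puts two different uniform structures on [C] (as an absolute ring
   and as a product); this form is usable with both. *)
Definition ccont (f : C -> C) (z : C) : Prop :=
  forall eps : R, 0 < eps -> exists delta : R, 0 < delta /\
    forall w : C, Cmod (w - z) < delta -> Cmod (f w - f z) < eps.

Lemma Cmod_sub_sym (a b : C) : Cmod (a - b) = Cmod (b - a).
Proof. replace (a - b)%C with (- (b - a))%C by ring. apply Cmod_opp. Qed.

Lemma Cmod_sub_triangle (a b c : C) :
  Cmod (a - c) <= Cmod (a - b) + Cmod (b - c).
Proof.
replace (a - c)%C with ((a - b) + (b - c))%C by ring. apply Cmod_triangle.
Qed.

Lemma Cmod_le_plus (a b : C) : Cmod a <= Cmod (a - b) + Cmod b.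
Proof. replace a with ((a - b) + b)%C at 1 by ring. apply Cmod_triangle. Qed.

Lemma Cmod_sub_ge (a b : C) : Cmod a - Cmod b <= Cmod (a - b).
Proof. generalize (Cmod_le_plus a b); lra. Qed.

Lemma Cmod_neq_0 (z : C) : 0 < Cmod z -> z <> 0.
Proof. apply Cmod_gt_0. Qed.

Lemma Cmod_small_eq_0 (z : C) : (forall eps, 0 < eps -> Cmod z <= eps) -> z = 0.
Proof.
intros H. apply Cmod_eq_0, Rle_antisym; [|apply Cmod_ge_0].
apply le_epsilon. intros e he. rewrite Rplus_0_l. now apply H.
Qed.

Lemma ccont_const (c z : C) : ccont (fun _ => c) z.
Proof.
intros e he. exists 1; split; [lra|]. intros w _.
replace (c - c)%C with (RtoC 0) by ring. now rewrite Cmod_0.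
Qed.

Lemma ccont_id (z : C) : ccont (fun w => w) z.
Proof. intros e he. now exists e. Qed.

Lemma ccont_minus (f g : C -> C) (z : C) :
  ccont f z -> ccont g z -> ccont (fun w => f w - g w)%C z.
Proof.
intros hf hg e he.
destruct (hf (e / 2)) as [d1 [h1 k1]]; [lra|].
destruct (hg (e / 2)) as [d2 [h2 k2]]; [lra|].
exists (Rmin d1 d2); split; [now apply Rmin_glb_lt|].
intros w hw.
assert (Cmod (f w - f z) < e / 2) by (apply k1; apply Rlt_le_trans with (1 := hw); apply Rmin_l).
assert (Cmod (g w - g z) < e / 2) by (apply k2; apply Rlt_le_trans with (1 := hw); apply Rmin_r).
replace (f w - g w - (f z - g z))%C with ((f w - f z) + - (g w - g z))%C by ring.
apply Rle_lt_trans with (1 := Cmod_triangle _ _). rewrite Cmod_opp. lra.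
Qed.

Lemma ccont_mult (f g : C -> C) (z : C) :
  ccont f z -> ccont g z -> ccont (fun w => f w * g w)%C z.
Proof.
intros hf hg e he.
set (a := Cmod (f z)). set (b := Cmod (g z)).
assert (ha : 0 <= a) by apply Cmod_ge_0.
assert (hb : 0 <= b) by apply Cmod_ge_0.
assert (h0 : 0 < e / (a + b + 1)) by (apply Rdiv_lt_0_compat; lra).
(* As [k <= 1], the product of the two increments is below [k]; the three terms of the expansion add
   up to less than [k * (a + b + 1)]. *)
set (k := Rmin 1 (e / (a + b + 1))).
assert (hk : 0 < k) by (apply Rmin_glb_lt; lra).
assert (hk1 : k <= 1) by apply Rmin_l.
assert (hk2 : k * (a + b + 1) <= e).
{ apply Rle_trans with (e / (a + b + 1) * (a + b + 1)).
  - apply Rmult_le_compat_r; [lra|apply Rmin_r].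
  - right; field; lra. }
destruct (hf k hk) as [d1 [h1 k1]].
destruct (hg k hk) as [d2 [h2 k2]].
exists (Rmin d1 d2); split; [now apply Rmin_glb_lt|].
intros w hw.
assert (u : Cmod (f w - f z) < k) by (apply k1; apply Rlt_le_trans with (1 := hw); apply Rmin_l).
assert (v : Cmod (g w - g z) < k) by (apply k2; apply Rlt_le_trans with (1 := hw); apply Rmin_r).
replace (f w * g w - f z * g z)%C
  with ((f w - f z) * (g w - g z) + (f z * (g w - g z) + g z * (f w - f z)))%C by ring.
apply Rle_lt_trans with (1 := Cmod_triangle _ _).
generalize (Cmod_triangle (f z * (g w - g z)) (g z * (f w - f z))).
rewrite !Cmod_mult. fold a b.
generalize (Cmod_ge_0 (f w - f z)) (Cmod_ge_0 (g w - g z)).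
intros. nra.
Qed.

Lemma ccont_inv (f : C -> C) (z : C) :
  ccont f z -> f z <> 0 -> ccont (fun w => / f w)%C z.
Proof.
intros hf hz e he.
assert (ha : 0 < Cmod (f z)) by now apply Cmod_gt_0.
set (a := Cmod (f z)) in *.
destruct (hf (Rmin (a / 2) (e * (a * a / 2)))) as [d [hd kd]].
{ apply Rmin_glb_lt; [lra|]. apply Rmult_lt_0_compat; [lra|nra]. }
exists d; split; [assumption|].
intros w hw. specialize (kd w hw).
assert (k1 := Rlt_le_trans _ _ _ kd (Rmin_l _ _)).
assert (k2 := Rlt_le_trans _ _ _ kd (Rmin_r _ _)).
assert (hb : a / 2 < Cmod (f w)).
{ generalize (Cmod_sub_ge (f z) (f w)). rewrite Cmod_sub_sym. fold a. lra. }
assert (hw0 : f w <> 0) by (apply Cmod_neq_0; lra).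
replace (/ f w - / f z)%C with (- (f w - f z) / (f w * f z))%C by (field; auto).
rewrite Cmod_div by now apply Cmult_neq_0.
rewrite Cmod_opp, Cmod_mult. fold a.
apply Rlt_div_l; [nra|].
apply Rlt_le_trans with (1 := k2). apply Rmult_le_compat_l; nra.
Qed.

Lemma ccont_div (f g : C -> C) (z : C) :
  ccont f z -> ccont g z -> g z <> 0 -> ccont (fun w => f w / g w)%C z.
Proof. intros hf hg h. apply ccont_mult; [easy|now apply ccont_inv]. Qed.

Lemma ccont_ext_loc (f g : C -> C) (z : C) (delta : R) : 0 < delta ->
  (forall w, Cmod (w - z) < delta -> f w = g w) -> ccont f z -> ccont g z.
Proof.
intros hd h hf e he. destruct (hf e he) as [d [h1 k1]].
exists (Rmin d delta); split; [now apply Rmin_glb_lt|].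
intros w hw. rewrite <- !h.
- apply k1, Rlt_le_trans with (1 := hw), Rmin_l.
- replace (z - z)%C with (RtoC 0) by ring. now rewrite Cmod_0.
- apply Rlt_le_trans with (1 := hw), Rmin_r.
Qed.

(* Caratheodory's form of complex differentiability. *)
Definition cdiff (f : C -> C) (z : C) : Prop :=
  exists (phi : C -> C) (delta : R), ccont phi z /\ 0 < delta /\
    forall w, Cmod (w - z) < delta -> (f w - f z = phi w * (w - z))%C.

Lemma is_derive_C_bound (f : C -> C) (z l : C) :
  is_derive (K := C_AbsRing) (V := C_NormedModule) f z l ->
  forall eps, 0 < eps -> exists delta, 0 < delta /\
    forall w, Cmod (w - z) < delta ->
      Cmod (f w - f z - l * (w - z)) <= eps * Cmod (w - z).
Proof.
intros [_ h] e he.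
destruct (h z (fun P H => H) (mkposreal e he)) as [d hd].
exists d; split; [apply cond_pos|].
intros w hw. specialize (hd w hw).
replace (f w - f z - l * (w - z))%C with (f w - f z - (w - z) * l)%C by ring.
exact hd.
Qed.

(** The difference quotient, completed by [l] at [z]. The factorisation holds for every [w], so this
    quotient can later serve as an integrand over a whole circle. *)
Lemma is_derive_slope (f : C -> C) (z l : C) :
  is_derive (K := C_AbsRing) (V := C_NormedModule) f z l ->
  exists phi : C -> C, ccont phi z /\ phi z = l /\
    forall w, (f w - f z = phi w * (w - z))%C.
Proof.
intros h.
exists (fun w => if Ceq_dec w z then l else (f w - f z) / (w - z))%C.
assert (e0 : (if Ceq_dec z z then l else (f z - f z) / (z - z))%C = l).
{ now destruct (Ceq_dec z z). }
split; [|split; [exact e0|]].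
- intros e he. destruct (is_derive_C_bound f z l h (e / 2)) as [d [hd k]]; [lra|].
  exists d; split; [easy|]. intros w hw. rewrite e0.
  destruct (Ceq_dec w z) as [_|n].
  + replace (l - l)%C with (RtoC 0) by ring. now rewrite Cmod_0.
  + assert (n' : (w - z)%C <> 0) by now apply Cminus_eq_contra.
    replace ((f w - f z) / (w - z) - l)%C with ((f w - f z - l * (w - z)) / (w - z))%C
      by now field.
    rewrite Cmod_div by easy.
    assert (hp : 0 < Cmod (w - z)) by now apply Cmod_gt_0.
    apply Rlt_div_l; [easy|]. specialize (k w hw). nra.
- intros w. destruct (Ceq_dec w z) as [->|n].
  + ring.
  + field. now apply Cminus_eq_contra.
Qed.

Lemma slope_ccont (f phi : C -> C) (z : C) (delta : R) : 0 < delta -> ccont phi z ->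
  (forall w, Cmod (w - z) < delta -> (f w - f z = phi w * (w - z))%C) -> ccont f z.
Proof.
intros hd hphi h.
apply ccont_ext_loc with (f := fun w => (phi w * (w - z) - (0 - f z))%C) (delta := delta); [easy| |].
- intros w hw. rewrite <- h by easy. ring.
- apply ccont_minus; [apply ccont_mult|]; [easy| |apply ccont_const].
  apply ccont_minus; [apply ccont_id|apply ccont_const].
Qed.

Lemma cdiff_ccont (f : C -> C) (z : C) : cdiff f z -> ccont f z.
Proof. intros [phi [d [h [hd k]]]]. now apply slope_ccont with phi d. Qed.

Lemma ccont_continuous (f : C -> C) (z : C) :
  ccont f z -> continuous (T := CR) (U := CR) f z.
Proof.
intros h. apply filterlim_locally. intros e.
destruct (h e (cond_pos e)) as [d [hd k]].
(* Balls of the product structure are squares, contained in disks whose radius is larger by the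
   factor [sqrt 2]. *)
assert (hs : 0 < d / sqrt 2) by (apply Rdiv_lt_0_compat; [easy|apply sqrt_lt_R0; lra]).
exists (mkposreal _ hs). intros w hw.
apply C_NormedModule_mixin_compat1.
apply k.
assert (b := C_NormedModule_mixin_compat2 z w (mkposreal _ hs) hw).
simpl in b. apply Rlt_le_trans with (1 := b). right. field.
apply Rgt_not_eq, sqrt_lt_R0; lra.
Qed.

(** The limit is the sum of the telescoping series, which converges absolutely. Serves both the
    nested triangles of [goursat] and the fixed point iteration. *)
Lemma geometric_increments_limit (u : nat -> C) (c q : R) : 0 <= q < 1 ->
  (forall n, Cmod (u (S n) - u n) <= c * q ^ n) ->
  exists l : C, forall n, Cmod (u n - l) <= c * q ^ n / (1 - q).
Proof.
intros hq hu.
assert (hc : 0 <= c) by (generalize (hu 0%nat) (Cmod_ge_0 (u 1%nat - u 0%nat)); simpl; lra).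
(* The exact partial sum of the geometric series, with its factor [1 - q ^ m], is what makes the
   induction close. *)
assert (hd : forall n m, Cmod (u n - u (n + m)%nat) <= c * q ^ n * (1 - q ^ m) / (1 - q)).
{ intros n m. induction m as [|m IH].
  - rewrite Nat.add_0_r. replace (u n - u n)%C with (RtoC 0) by ring.
    rewrite Cmod_0. simpl. right; field; lra.
  - replace (n + S m)%nat with (S (n + m)) by lia.
    apply Rle_trans with (1 := Cmod_sub_triangle _ (u (n + m)%nat) _).
    rewrite (Cmod_sub_sym (u (n + m)%nat)).
    specialize (hu (n + m)%nat).
    apply Rle_trans with (1 := Rplus_le_compat _ _ _ _ IH hu).
    rewrite pow_add. simpl. right; field; lra. }
assert (hs : ex_series (V := CR) (fun n => u (S n) - u n)%C).
{ apply (ex_series_le (V := CR)) with (b := fun n => c * q ^ n).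
  - intros n. rewrite <- Cmod_norm. apply hu.
  - apply (ex_series_scal_l (K := R_AbsRing) c (fun n => q ^ n)).
    apply ex_series_geom. rewrite Rabs_pos_eq; lra. }
destruct hs as [s hs].
assert (hsum : forall n, sum_n (G := CR) (fun n => u (S n) - u n)%C n = (u (S n) - u 0%nat)%C).
{ intros n. induction n as [|n IH].
  - now rewrite sum_O.
  - rewrite sum_Sn, IH.
    change (u (S n) - u 0%nat + (u (S (S n)) - u (S n)) = u (S (S n)) - u 0%nat)%C. ring. }
exists (s + u 0%nat)%C. intros n. apply le_epsilon. intros e he.
assert (h2 : 0 < e / sqrt 2) by (apply Rdiv_lt_0_compat; [easy|apply sqrt_lt_R0; lra]).
assert (hs' := proj1 (filterlim_locally _ _) hs (mkposreal _ h2)).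
destruct hs' as [N hN]. specialize (hN (N + n)%nat (Nat.le_add_r _ _)).
rewrite hsum in hN.
assert (b := C_NormedModule_mixin_compat2 _ _ (mkposreal _ h2) hN).
simpl in b. replace (sqrt 2 * (e / sqrt 2)) with e in b
  by (field; apply Rgt_not_eq, sqrt_lt_R0; lra).
assert (b2 : Cmod (u (S (N + n)) - (s + u 0%nat)) < e).
{ replace (u (S (N + n)) - (s + u 0%nat))%C with (u (S (N + n)) - u 0%nat - s)%C by ring.
  exact b. }
apply Rle_trans with (1 := Cmod_sub_triangle _ (u (S (N + n))) _).
apply Rplus_le_compat; [|lra].
specialize (hd n (S N)). replace (n + S N)%nat with (S (N + n)) in hd by lia.
apply Rle_trans with (1 := hd).
unfold Rdiv. apply Rmult_le_compat_r; [left; apply Rinv_0_lt_compat; lra|].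
assert (0 <= q ^ n) by (apply pow_le; lra).
assert (0 <= q ^ S N) by (apply pow_le; lra).
assert (0 <= c * q ^ n) by now apply Rmult_le_pos. nra.
Qed.

(** * Integrals along segments *)

(** [CR] is a module over the reals, so a complex factor is not a [scal]; it is moved through the
    integral by components. *)
Lemma is_RInt_Cmult (c l : C) (f : R -> C) (a b : R) :
  is_RInt (V := CR) f a b l -> is_RInt (V := CR) (fun t => c * f t)%C a b (c * l)%C.
Proof.
intros h.
assert (h1 := is_RInt_fct_extend_fst _ _ _ _ h).
assert (h2 := is_RInt_fct_extend_snd _ _ _ _ h).
destruct c as [c1 c2].
apply (is_RInt_fct_extend_pair (U := R_NormedModule) (V := R_NormedModule)); simpl.
- exact (is_RInt_minus _ _ _ _ _ _ (is_RInt_scal _ _ _ c1 _ h1) (is_RInt_scal _ _ _ c2 _ h2)).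
- exact (is_RInt_plus _ _ _ _ _ _ (is_RInt_scal _ _ _ c1 _ h2) (is_RInt_scal _ _ _ c2 _ h1)).
Qed.

Definition seg_int (f : C -> C) (a b : C) : C :=
  ((b - a) * RInt (V := CR) (fun t => f (a + RtoC t * (b - a))%C) 0 1)%C.

Lemma line_continuous (f : C -> C) (p v : C) (t : R) :
  ccont f (p + RtoC t * v)%C ->
  continuous (T := R_UniformSpace) (U := CR) (fun t => f (p + RtoC t * v)%C) t.
Proof.
intros h. apply (filterlim_locally (U := CR)). intros e.
destruct (h e (cond_pos e)) as [d [hd k]].
assert (hv : 0 < Cmod v + 1) by (generalize (Cmod_ge_0 v); lra).
assert (hs : 0 < d / (Cmod v + 1)) by now apply Rdiv_lt_0_compat.
exists (mkposreal _ hs). intros s hs'.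
apply C_NormedModule_mixin_compat1. apply k.
replace (p + RtoC s * v - (p + RtoC t * v))%C with (RtoC (s - t) * v)%C
  by (rewrite RtoC_minus; ring).
rewrite Cmod_mult, Cmod_R.
assert (hs2 : Rabs (s - t) < d / (Cmod v + 1)) by exact hs'.
apply Rlt_div_r in hs2; [|easy].
generalize (Rabs_pos (s - t)) (Cmod_ge_0 v). intros. nra.
Qed.

Definition cont_seg (f : C -> C) (a b : C) : Prop :=
  forall t, 0 <= t <= 1 -> ccont f (a + RtoC t * (b - a))%C.

Lemma is_RInt_line (f : C -> C) (p v : C) (a b : R) :
  (forall t, Rmin a b <= t <= Rmax a b -> ccont f (p + RtoC t * v)%C) ->
  is_RInt (V := CR) (fun t => f (p + RtoC t * v)%C) a b
    (RInt (V := CR) (fun t => f (p + RtoC t * v)%C) a b).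
Proof.
intros h. apply RInt_correct, ex_RInt_continuous.
intros t ht. now apply line_continuous, h.
Qed.

(** Brings all segments of one line to a common parametrisation; reversing and splitting a segment
    then become the swap of bounds and the Chasles relation for one real integral. *)
Lemma seg_line (f : C -> C) (p v : C) (a b : R) :
  (forall t, Rmin a b <= t <= Rmax a b -> ccont f (p + RtoC t * v)%C) ->
  seg_int f (p + RtoC a * v) (p + RtoC b * v)
  = (v * RInt (V := CR) (fun t => f (p + RtoC t * v)%C) a b)%C.
Proof.
intros h. assert (hi := is_RInt_line f p v a b h).
set (I := RInt _ a b) in *. unfold seg_int.
replace (p + RtoC b * v - (p + RtoC a * v))%C with (RtoC (b - a) * v)%C
  by (rewrite RtoC_minus; ring).
assert (hc := is_RInt_comp_lin (V := CR) (fun t => f (p + RtoC t * v)%C) (b - a) a 0 1 I).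
assert (hc' : is_RInt (V := CR) (fun y => scal (b - a) (f (p + RtoC ((b - a) * y + a) * v)%C)) 0 1 I).
{ apply hc. replace ((b - a) * 0 + a) with a by ring.
  replace ((b - a) * 1 + a) with b by ring. exact hi. }
rewrite (Cmult_comm (RtoC (b - a)) v), <- Cmult_assoc. f_equal.
(* The change of variable leaves a factor [b - a], which can be divided out only if it is nonzero;
   otherwise both sides vanish. *)
destruct (Req_dec (b - a) 0) as [e0|n0].
- rewrite e0, Cmult_0_l. unfold I. replace b with a by lra.
  rewrite RInt_point. reflexivity.
- assert (n1 : RtoC (b - a) <> 0) by (intros e; apply n0, RtoC_inj, e).
  assert (hk := is_RInt_Cmult (/ RtoC (b - a))%C _ _ _ _ hc').
  rewrite (is_RInt_unique (V := CR) _ 0 1 (/ RtoC (b - a) * I)%C).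
  + field; exact n1.
  + apply (is_RInt_ext (V := CR)) with (2 := hk). intros t _.
    rewrite scal_R_Cmult, RtoC_plus, RtoC_mult.
    rewrite Cmult_assoc, Cinv_l, Cmult_1_l by exact n1. f_equal. ring.
Qed.

Lemma seg_anti (f : C -> C) (a b : C) : cont_seg f a b -> seg_int f b a = (- seg_int f a b)%C.
Proof.
intros h.
assert (e0 : a = (a + RtoC 0 * (b - a))%C) by ring.
assert (e1 : b = (a + RtoC 1 * (b - a))%C) by ring.
assert (h1 := seg_line f a (b - a)%C 1 0). assert (h2 := seg_line f a (b - a)%C 0 1).
rewrite <- e0, <- e1 in h1, h2.
rewrite h1, h2.
- rewrite <- (opp_RInt_swap (V := CR)).
  + change (((b - a) * (- RInt (V:=CR) (fun t : R => f (a + t * (b - a))%C) 0 1)) =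
     - ((b - a) * RInt (V:=CR) (fun t : R => f (a + t * (b - a))%C) 0 1))%C. ring.
  + eexists. apply is_RInt_line. rewrite Rmin_left, Rmax_right by lra. exact h.
- rewrite Rmin_left, Rmax_right by lra. exact h.
- rewrite Rmin_right, Rmax_left by lra. exact h.
Qed.

Lemma seg_split (f : C -> C) (a b m : C) (s : R) : 0 <= s <= 1 ->
  m = (a + RtoC s * (b - a))%C -> cont_seg f a b ->
  seg_int f a b = (seg_int f a m + seg_int f m b)%C.
Proof.
intros hs hm h.
assert (e0 : a = (a + RtoC 0 * (b - a))%C) by ring.
assert (e1 : b = (a + RtoC 1 * (b - a))%C) by ring.
assert (h1 := seg_line f a (b - a)%C 0 s). assert (h2 := seg_line f a (b - a)%C s 1).
assert (h3 := seg_line f a (b - a)%C 0 1).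
rewrite <- e0 in h1, h3. rewrite <- e1 in h2, h3. rewrite <- hm in h1, h2.
assert (k1 : forall t, Rmin 0 s <= t <= Rmax 0 s -> ccont f (a + t * (b - a))%C).
{ rewrite Rmin_left, Rmax_right by lra. intros t ht. apply h; lra. }
assert (k2 : forall t, Rmin s 1 <= t <= Rmax s 1 -> ccont f (a + t * (b - a))%C).
{ rewrite Rmin_left, Rmax_right by lra. intros t ht. apply h; lra. }
assert (k3 : forall t, Rmin 0 1 <= t <= Rmax 0 1 -> ccont f (a + t * (b - a))%C).
{ rewrite Rmin_left, Rmax_right by lra. intros t ht. apply h; lra. }
rewrite h1, h2, h3 by assumption.
rewrite <- (RInt_Chasles (V := CR) _ 0 s 1).
- change plus with Cplus. ring.
- eexists; now apply is_RInt_line.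
- eexists; now apply is_RInt_line.
Qed.

Lemma is_RInt_affine (u v : C) :
  is_RInt (V := CR) (fun t => u + RtoC t * v)%C 0 1 (u + v / RtoC 2)%C.
Proof.
assert (real : forall x y : R, is_RInt (fun t => x + t * y) 0 1 (x + y / 2)).
{ intros x y.
  replace (x + y / 2) with (minus (x * 1 + y * 1 ^ 2 / 2) (x * 0 + y * 0 ^ 2 / 2))
    by (unfold minus, plus, opp; simpl; field).
  apply (is_RInt_derive (fun t => x * t + y * t ^ 2 / 2)).
  - intros t _. auto_derive; [easy|field].
  - intros t _. apply (ex_derive_continuous (fun t => x + t * y)). auto_derive. easy. }
destruct u as [x1 y1], v as [x2 y2].
replace ((x1, y1) + (x2, y2) / RtoC 2)%C with (x1 + x2 / 2, y1 + y2 / 2)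
  by (apply injective_projections; simpl; field).
apply (is_RInt_fct_extend_pair (U := R_NormedModule) (V := R_NormedModule)).
- apply is_RInt_ext with (2 := real x1 x2). intros; simpl; ring.
- apply is_RInt_ext with (2 := real y1 y2). intros; simpl; ring.
Qed.

(** The subtracted term is the exact integral of [al + be * x] along the segment, the midpoint rule
    being exact for affine functions. With [be = 0] this also covers approximation by a constant. *)
Lemma seg_affine_approx (f : C -> C) (al be a b : C) (eta : R) :
  cont_seg f a b ->
  (forall t, 0 <= t <= 1 -> let x := (a + RtoC t * (b - a))%C in
     Cmod (f x - (al + be * x)) <= eta) ->
  Cmod (seg_int f a b - (b - a) * (al + be * (a + b) / RtoC 2)) <= Cmod (b - a) * eta.
Proof.
intros hc hb. unfold seg_int.
assert (h1 := is_RInt_line f a (b - a)%C 0 1).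
rewrite Rmin_left, Rmax_right in h1 by lra. specialize (h1 hc).
set (I := RInt _ 0 1) in *.
assert (h2 := is_RInt_affine (al + be * a) (be * (b - a))).
assert (h := is_RInt_minus (V := CR) _ _ _ _ _ _ h1 h2).
replace ((b - a) * I - (b - a) * (al + be * (a + b) / RtoC 2))%C
  with ((b - a) * (I - (al + be * a + be * (b - a) / RtoC 2)))%C
  by (field; intros e; apply RtoC_inj in e; lra).
rewrite Cmod_mult. apply Rmult_le_compat_l; [apply Cmod_ge_0|].
replace eta with ((1 - 0) * eta) by ring.
rewrite Cmod_norm.
apply (norm_RInt_le_const (V := CR)) with (3 := h); [lra|].
intros t ht. rewrite <- Cmod_norm.
specialize (hb t ht). simpl in hb.
apply Rle_trans with (2 := hb). right. f_equal.
unfold minus, plus, opp; simpl.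
change (f (a + t * (b - a)) - (al + be * a + t * (be * (b - a)))
  = f (a + t * (b - a)) - (al + be * (a + t * (b - a))))%C. ring.
Qed.

(** * Goursat's theorem for triangles *)

Definition tri_int (f : C -> C) (a b c : C) : C := (seg_int f a b + seg_int f b c + seg_int f c a)%C.

Definition perimeter (a b c : C) : R := Cmod (b - a) + Cmod (c - b) + Cmod (a - c).

Definition convex (K : C -> Prop) : Prop :=
  forall a b t, K a -> K b -> 0 <= t <= 1 -> K (a + RtoC t * (b - a))%C.

Definition adherent (K : C -> Prop) (p : C) : Prop :=
  forall eps : R, 0 < eps -> exists x, K x /\ Cmod (x - p) < eps.

Definition mid (a b : C) : C := (a + RtoC (1 / 2) * (b - a))%C.

Lemma Cmod_half (a b c d : C) : (c - d = RtoC (1 / 2) * (a - b))%C ->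
  Cmod (c - d) = Cmod (a - b) / 2.
Proof. intros ->. rewrite Cmod_mult, Cmod_R, Rabs_pos_eq; lra. Qed.

Lemma RtoC_half : RtoC (1 / 2) = (/ RtoC 2)%C.
Proof. rewrite <- RtoC_inv by lra. f_equal; lra. Qed.

Lemma RtoC_2_neq_0 : RtoC 2 <> 0.
Proof. intros e; apply RtoC_inj in e; lra. Qed.

Lemma convex_cont_seg (K : C -> Prop) (f : C -> C) (a b : C) : convex K ->
  (forall p, K p -> ccont f p) -> K a -> K b -> cont_seg f a b.
Proof. intros hK hf ha hb t ht. now apply hf, hK. Qed.

(** All four triangles keep the orientation of the large one, so each inner side is run through once
    in each direction and cancels. *)
Lemma tri_subdivision (K : C -> Prop) (f : C -> C) (a b c : C) : convex K ->
  (forall p, K p -> ccont f p) -> K a -> K b -> K c ->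
  tri_int f a b c = (tri_int f a (mid a b) (mid c a) + tri_int f b (mid b c) (mid a b)
    + tri_int f c (mid c a) (mid b c) + tri_int f (mid a b) (mid b c) (mid c a))%C.
Proof.
intros hK hf ha hb hc.
assert (hm : forall x y, K x -> K y -> K (mid x y)) by (intros; apply hK; trivial; lra).
assert (hs := fun x y => convex_cont_seg K f x y hK hf).
assert (hsp : forall x y, K x -> K y -> seg_int f x y = (seg_int f x (mid x y) + seg_int f (mid x y) y)%C).
{ intros x y hx hy. apply seg_split with (s := 1 / 2); [lra|easy|now apply hs]. }
unfold tri_int. rewrite (hsp a b), (hsp b c), (hsp c a) by easy.
rewrite (seg_anti f (mid a b) (mid b c)), (seg_anti f (mid b c) (mid c a)),
  (seg_anti f (mid c a) (mid a b)) by auto.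
ring.
Qed.

(** One of the four pieces carries at least a quarter of the integral. The bound on [a' - a] will
    make the first vertices of the nested triangles a Cauchy sequence. *)
Lemma tri_quarter (K : C -> Prop) (f : C -> C) (a b c : C) : convex K ->
  (forall p, K p -> ccont f p) -> K a -> K b -> K c ->
  exists a' b' c', K a' /\ K b' /\ K c' /\
    perimeter a' b' c' = perimeter a b c / 2 /\
    Cmod (a' - a) <= perimeter a b c /\
    Cmod (tri_int f a b c) / 4 <= Cmod (tri_int f a' b' c').
Proof.
intros hK hf ha hb hc.
assert (hm : forall x y, K x -> K y -> K (mid x y)) by (intros; apply hK; trivial; lra).
assert (e := tri_subdivision K f a b c hK hf ha hb hc).
assert (n1 := Cmod_ge_0 (b - a)). assert (n2 := Cmod_ge_0 (c - b)).
assert (n3 := Cmod_ge_0 (a - c)).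
assert (hp : forall x y z, x = Cmod (b - a) / 2 -> y = Cmod (c - b) / 2 ->
  z = Cmod (a - c) / 2 -> x + y + z = perimeter a b c / 2).
{ intros. unfold perimeter. lra. }
set (t1 := tri_int f a (mid a b) (mid c a)) in e.
set (t2 := tri_int f b (mid b c) (mid a b)) in e.
set (t3 := tri_int f c (mid c a) (mid b c)) in e.
set (t4 := tri_int f (mid a b) (mid b c) (mid c a)) in e.
assert (hle : Cmod (tri_int f a b c) <= Cmod t1 + Cmod t2 + Cmod t3 + Cmod t4).
{ rewrite e. apply Rle_trans with (1 := Cmod_triangle _ _), Rplus_le_compat_r.
  apply Rle_trans with (1 := Cmod_triangle _ _), Rplus_le_compat_r, Cmod_triangle. }
set (m := Cmod (tri_int f a b c)) in *.
assert (hcase : m / 4 <= Cmod t1 \/ m / 4 <= Cmod t2 \/ m / 4 <= Cmod t3 \/ m / 4 <= Cmod t4).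
{ destruct (Rle_lt_dec (m / 4) (Cmod t1)); [tauto|].
  destruct (Rle_lt_dec (m / 4) (Cmod t2)); [tauto|].
  destruct (Rle_lt_dec (m / 4) (Cmod t3)); [tauto|].
  right; right; right; lra. }
assert (h2 := RtoC_2_neq_0).
destruct hcase as [h|[h|[h|h]]].
- exists a, (mid a b), (mid c a). repeat split; auto.
  + unfold perimeter.
    rewrite (Cmod_half b a (mid a b) a), (Cmod_half c b (mid c a) (mid a b)),
      (Cmod_half a c a (mid c a)); [lra| | | ]; unfold mid; rewrite RtoC_half; field; exact h2.
  + replace (a - a)%C with (RtoC 0) by ring. rewrite Cmod_0. unfold perimeter; lra.
- exists b, (mid b c), (mid a b). repeat split; auto.
  + unfold perimeter.
    rewrite (Cmod_half c b (mid b c) b), (Cmod_half a c (mid a b) (mid b c)),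
      (Cmod_half b a b (mid a b)); [lra| | | ]; unfold mid; rewrite RtoC_half; field; exact h2.
  + unfold perimeter; lra.
- exists c, (mid c a), (mid b c). repeat split; auto.
  + unfold perimeter.
    rewrite (Cmod_half a c (mid c a) c), (Cmod_half b a (mid b c) (mid c a)),
      (Cmod_half c b c (mid b c)); [lra| | | ]; unfold mid; rewrite RtoC_half; field; exact h2.
  + unfold perimeter. rewrite (Cmod_sub_sym c a). lra.
- exists (mid a b), (mid b c), (mid c a). repeat split; auto.
  + unfold perimeter.
    rewrite (Cmod_half c a (mid b c) (mid a b)), (Cmod_half a b (mid c a) (mid b c)),
      (Cmod_half b c (mid a b) (mid c a)), (Cmod_sub_sym c a), (Cmod_sub_sym a b),
      (Cmod_sub_sym b c); [lra| | | ]; unfold mid; rewrite RtoC_half; field; exact h2.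
  + rewrite (Cmod_half b a (mid a b) a); [unfold perimeter; lra|].
    unfold mid; rewrite RtoC_half; field; exact h2.
Qed.

(** An affine function has integral zero around a triangle, because (b^2 - a^2)/2 telescopes; only
    the approximation error remains. *)
Lemma tri_affine_approx (f : C -> C) (al be a b c p : C) (r eta : R) :
  cont_seg f a b -> cont_seg f b c -> cont_seg f c a ->
  Cmod (a - p) <= r ->
  (forall x, Cmod (x - p) <= r + perimeter a b c -> Cmod (f x - (al + be * x)) <= eta) ->
  Cmod (tri_int f a b c) <= perimeter a b c * eta.
Proof.
intros h1 h2 h3 ha hx.
assert (n1 := Cmod_ge_0 (b - a)). assert (n2 := Cmod_ge_0 (c - b)).
assert (n3 := Cmod_ge_0 (a - c)).
(* Here [d] is the length already walked from [a] to [u]; the whole walk never exceeds the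
   perimeter. *)
assert (hd : forall u v d, Cmod (u - p) <= r + d ->
   d + Cmod (v - u) <= perimeter a b c ->
   forall t, 0 <= t <= 1 -> let x := (u + RtoC t * (v - u))%C in
     Cmod (f x - (al + be * x)) <= eta).
{ intros u v d hu hd t ht x. apply hx. unfold x.
  replace (u + t * (v - u) - p)%C with ((u - p) + t * (v - u))%C by ring.
  apply Rle_trans with (1 := Cmod_triangle _ _).
  rewrite Cmod_mult, Cmod_R, Rabs_pos_eq by lra.
  generalize (Cmod_ge_0 (v - u)). nra. }
assert (s1 := seg_affine_approx f al be a b eta h1 (hd a b 0 ltac:(lra) ltac:(unfold perimeter; lra))).
assert (hb : Cmod (b - p) <= r + Cmod (b - a)).
{ generalize (Cmod_sub_triangle b a p). lra. }
assert (hc : Cmod (c - p) <= r + (Cmod (b - a) + Cmod (c - b))).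
{ generalize (Cmod_sub_triangle c b p). lra. }
assert (s2 := seg_affine_approx f al be b c eta h2 (hd b c _ hb ltac:(unfold perimeter; lra))).
assert (s3 := seg_affine_approx f al be c a eta h3 (hd c a _ hc ltac:(unfold perimeter; lra))).
replace (tri_int f a b c) with ((seg_int f a b - (b - a) * (al + be * (a + b) / RtoC 2))
  + (seg_int f b c - (c - b) * (al + be * (b + c) / RtoC 2))
  + (seg_int f c a - (a - c) * (al + be * (c + a) / RtoC 2)))%C
  by (unfold tri_int; field; exact RtoC_2_neq_0).
apply Rle_trans with (1 := Cmod_triangle _ _).
apply Rle_trans with (1 := Rplus_le_compat_r _ _ _ (Cmod_triangle _ _)).
unfold perimeter. lra.
Qed.

Lemma goursat (K : C -> Prop) (f : C -> C) (a b c : C) : convex K ->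
  (forall p, adherent K p -> K p) -> (forall p, K p -> cdiff f p) ->
  K a -> K b -> K c -> tri_int f a b c = 0.
Proof.
intros hK hcl hf ha hb hc.
assert (hcf : forall p, K p -> ccont f p) by (intros; now apply cdiff_ccont, hf).
(* The membership in [K] is put inside the relation, which makes it total on triples: outside [K]
   any successor will do. *)
destruct (functional_choice (fun x y : C * C * C =>
  let '(u, v, w) := x in let '(u', v', w') := y in
  K u -> K v -> K w -> K u' /\ K v' /\ K w' /\
    perimeter u' v' w' = perimeter u v w / 2 /\
    Cmod (u' - u) <= perimeter u v w /\
    Cmod (tri_int f u v w) / 4 <= Cmod (tri_int f u' v' w'))) as [step hstep].
{ intros [[u v] w].
  destruct (classic (K u /\ K v /\ K w)) as [[hu [hv hw]]|n].
  - destruct (tri_quarter K f u v w hK hcf hu hv hw) as [u' [v' [w' h]]].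
    now exists (u', v', w').
  - exists (u, v, w). tauto. }
set (q := fun n => Nat.iter n step (a, b, c)).
set (A := fun n => fst (fst (q n))). set (B := fun n => snd (fst (q n))).
set (D := fun n => snd (q n)).
assert (inv : forall n, K (A n) /\ K (B n) /\ K (D n) /\
   perimeter (A n) (B n) (D n) = perimeter a b c * (1 / 2) ^ n /\
   Cmod (tri_int f a b c) * (1 / 4) ^ n <= Cmod (tri_int f (A n) (B n) (D n))).
{ intros n. induction n as [|n [i1 [i2 [i3 [i4 i5]]]]].
  - unfold A, B, D, q; simpl. repeat split; trivial; lra.
  - specialize (hstep (q n)).
    unfold A, B, D in i1, i2, i3, i4, i5 |- *. unfold q at 1 2 3 4 5 6 7 8 9. simpl Nat.iter.
    fold (q n). destruct (q n) as [[u v] w]. destruct (step (u, v, w)) as [[u' v'] w'].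
    simpl in *. destruct (hstep i1 i2 i3) as [k1 [k2 [k3 [k4 [_ k6]]]]].
    repeat split; trivial; lra. }
assert (hinc : forall n, Cmod (A (S n) - A n) <= perimeter a b c * (1 / 2) ^ n).
{ intros n. destruct (inv n) as [i1 [i2 [i3 [i4 _]]]]. rewrite <- i4.
  specialize (hstep (q n)). unfold A, B, D in *. change (q (S n)) with (step (q n)).
  destruct (q n) as [[u v] w]. destruct (step (u, v, w)) as [[u' v'] w'].
  simpl in *. now apply hstep. }
destruct (geometric_increments_limit A _ (1 / 2) ltac:(lra) hinc) as [p hp].
set (l := perimeter a b c) in *.
assert (hl : 0 <= l).
{ unfold l, perimeter. generalize (Cmod_ge_0 (b - a)) (Cmod_ge_0 (c - b)) (Cmod_ge_0 (a - c)). lra. }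
(* The n-th triangle lies within 3 l / 2^n of [p]: 2 l / 2^n for its first vertex, plus its
   perimeter l / 2^n. *)
assert (hsmall : forall e, 0 < e -> exists n, 3 * l * (1 / 2) ^ n < e).
{ intros e he.
  destruct (pow_lt_1_zero (1 / 2) ltac:(rewrite Rabs_pos_eq; lra) (e / (3 * l + 1))) as [N hN].
  { apply Rdiv_lt_0_compat; lra. }
  exists N. specialize (hN N (Nat.le_refl _)).
  rewrite Rabs_pos_eq in hN by (apply pow_le; lra).
  apply Rlt_div_r in hN; [|lra]. assert (0 < (1 / 2) ^ N) by (apply pow_lt; lra). nra. }
assert (Kp : K p).
{ apply hcl. intros e he. destruct (hsmall e he) as [n hn]. exists (A n). split; [apply inv|].
  apply Rle_lt_trans with (1 := hp n). assert (0 < (1 / 2) ^ n) by (apply pow_lt; lra).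
  replace (l * (1 / 2) ^ n / (1 - 1 / 2)) with (2 * (l * (1 / 2) ^ n)) by field. nra. }
apply Cmod_small_eq_0. intros e he.
destruct (hf p Kp) as [phi [d [hphi [hd hw]]]].
(* If [phi] varies by less than k near [p], the n-th integral is at most perimeter times error, k (3
   l^2) / 4^n. The powers of 4 cancel against [tri_quarter], leaving k (3 l^2) <= e; the added 1
   covers l = 0. *)
assert (hk : 0 < e / (3 * l * l + 1)) by (apply Rdiv_lt_0_compat; nra).
destruct (hphi _ hk) as [d' [hd' hw']].
destruct (hsmall (Rmin d d')) as [n hn]; [now apply Rmin_glb_lt|].
destruct (inv n) as [i1 [i2 [i3 [i4 i5]]]].
set (k := e / (3 * l * l + 1)) in *.
assert (hpow : 0 < (1 / 2) ^ n) by (apply pow_lt; lra).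
assert (hr : Cmod (A n - p) <= 2 * (l * (1 / 2) ^ n)).
{ apply Rle_trans with (1 := hp n). right; field. }
assert (hcs := fun x y => convex_cont_seg K f x y hK hcf).
assert (ht := tri_affine_approx f (f p - phi p * p)%C (phi p) (A n) (B n) (D n) p
  (2 * (l * (1 / 2) ^ n)) (k * (3 * l * (1 / 2) ^ n))
  (hcs _ _ i1 i2) (hcs _ _ i2 i3) (hcs _ _ i3 i1) hr).
assert (hT : Cmod (tri_int f (A n) (B n) (D n)) <=
   perimeter (A n) (B n) (D n) * (k * (3 * l * (1 / 2) ^ n))).
{ apply ht. rewrite i4. intros x hx.
  assert (hx3 : Cmod (x - p) <= 3 * l * (1 / 2) ^ n) by lra.
  assert (hxd := Rlt_le_trans _ _ _ hn (Rmin_l d d')).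
  assert (hxd' := Rlt_le_trans _ _ _ hn (Rmin_r d d')).
  replace (f x - (f p - phi p * p + phi p * x))%C with ((f x - f p) - phi p * (x - p))%C by ring.
  rewrite hw by lra.
  replace (phi x * (x - p) - phi p * (x - p))%C with ((phi x - phi p) * (x - p))%C by ring.
  rewrite Cmod_mult. specialize (hw' x ltac:(lra)).
  apply Rmult_le_compat; try apply Cmod_ge_0; lra. }
assert (h14 : (1 / 4) ^ n = (1 / 2) ^ n * (1 / 2) ^ n).
{ rewrite <- Rpow_mult_distr. f_equal. lra. }
rewrite i4 in hT. rewrite h14 in i5.
assert (hfin : Cmod (tri_int f a b c) * ((1 / 2) ^ n * (1 / 2) ^ n) <=
  k * (3 * l * l) * ((1 / 2) ^ n * (1 / 2) ^ n)) by lra.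
apply Rmult_le_reg_r in hfin; [|nra].
apply Rle_trans with (1 := hfin).
assert (hke : k * (3 * l * l + 1) = e) by (unfold k; field; nra). nra.
Qed.

(** * Primitives and integrals over circles *)

Lemma Cmod_line (a b : C) (t r : R) : Cmod a <= r -> Cmod b <= r -> 0 <= t <= 1 ->
  Cmod (a + RtoC t * (b - a)) <= r.
Proof.
intros ha hb ht.
replace (a + t * (b - a))%C with (RtoC (1 - t) * a + RtoC t * b)%C
  by (rewrite RtoC_minus; ring).
apply Rle_trans with (1 := Cmod_triangle _ _).
rewrite !Cmod_mult, !Cmod_R, !Rabs_pos_eq by lra. nra.
Qed.

Lemma disk_convex (r : R) : convex (disk r).
Proof.
intros a b t ha hb ht. unfold disk in *.
apply Rle_lt_trans with (Rmax (Cmod a) (Cmod b)).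
- apply Cmod_line; [apply Rmax_l|apply Rmax_r|easy].
- now apply Rmax_lub_lt.
Qed.

Lemma seg_point (f : C -> C) (a : C) : seg_int f a a = 0.
Proof. unfold seg_int. ring. Qed.

Definition dot (u x : C) : R := fst u * fst x + snd u * snd x.

Lemma dot_le_Cmod (u x : C) : Rabs (dot u x) <= Cmod u * Cmod x.
Proof.
replace (dot u x) with (Re (Cconj u * x)) by (unfold dot; simpl; ring).
apply Rle_trans with (1 := re_le_Cmod _). rewrite Cmod_mult, Cmod_conj. lra.
Qed.

Lemma Cmod_sqr (x : C) : Cmod x * Cmod x = dot x x.
Proof. generalize (Cmod2_alt x). unfold dot, Re, Im. lra. Qed.

(** For [d > 0] this set avoids [z], and for [r < 1] it stays in the unit disk: a domain for
    [goursat] when [z] is exceptional. *)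
Lemma half_disk_convex (r d : R) (u z : C) :
  convex (fun x => Cmod x <= r /\ d <= dot u (x - z)).
Proof.
intros a b t [a1 a2] [b1 b2] ht. split; [now apply Cmod_line|].
replace (dot u (a + t * (b - a) - z)) with ((1 - t) * dot u (a - z) + t * dot u (b - z))
  by (unfold dot; simpl; ring).
nra.
Qed.

Lemma half_disk_closed (r d : R) (u z p : C) :
  adherent (fun x => Cmod x <= r /\ d <= dot u (x - z)) p ->
  Cmod p <= r /\ d <= dot u (p - z).
Proof.
intros h. split; apply le_epsilon; intros e he.
- destruct (h e he) as [x [[h1 h2] h3]].
  generalize (Cmod_sub_ge p x). rewrite Cmod_sub_sym. lra.
- assert (hu := Cmod_ge_0 u).
  destruct (h (e / (Cmod u + 1))) as [x [[h1 h2] h3]]; [apply Rdiv_lt_0_compat; lra|].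
  apply Rlt_div_r in h3; [|lra].
  assert (h4 := dot_le_Cmod u (x - p)). apply Rabs_le_between in h4.
  replace (dot u (p - z)) with (dot u (x - z) - dot u (x - p)) by (unfold dot; simpl; ring).
  generalize (Cmod_ge_0 (x - p)). nra.
Qed.

(* If the exceptional point [z0] lies on the opposite side, the triangle is
   degenerate.  Otherwise cut off a small triangle at the vertex [z0]: a half
   plane separates the rest from [z0]. *)
Lemma tri_exceptional_vertex (f : C -> C) (z0 w w' : C) :
  (forall p, disk 1 p -> ccont f p) ->
  (forall p, disk 1 p -> p <> z0 -> cdiff f p) ->
  disk 1 z0 -> disk 1 w -> disk 1 w' -> tri_int f z0 w w' = 0.
Proof.
intros hc hd h0 hw hw'.
assert (hs := fun x y => convex_cont_seg (disk 1) f x y (disk_convex 1) hc).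
set (v := (w - z0)%C). set (v' := (w' - z0)%C).
assert (ev : w = (z0 + v)%C) by (unfold v; ring).
assert (ev' : w' = (z0 + v')%C) by (unfold v'; ring).
(* By Cauchy-Schwarz [s] is nonnegative; it vanishes exactly when [v] and [v'] point in opposite
   directions or one of them is 0. *)
set (s := Cmod v * Cmod v' + dot v v').
assert (nv := Cmod_ge_0 v). assert (nv' := Cmod_ge_0 v').
destruct (Rle_lt_dec s 0) as [hs0|hs0].
- destruct (Rle_lt_or_eq_dec _ _ nv) as [nv0|zv].
  2:{ assert (e : v = 0) by now apply Cmod_eq_0.
      replace w with z0 by (rewrite ev, e; ring).
      unfold tri_int. rewrite seg_point, (seg_anti f z0 w') by auto. ring. }
  assert (ez : (RtoC (Cmod v') * v + RtoC (Cmod v) * v' = 0)%C).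
  { apply Cmod_eq_0.
    assert (h : dot (Cmod v' * v + Cmod v * v') (Cmod v' * v + Cmod v * v')
       = 2 * (Cmod v * Cmod v') * s).
    { assert (q1 := Cmod_sqr v). assert (q2 := Cmod_sqr v').
      replace (dot (Cmod v' * v + Cmod v * v') (Cmod v' * v + Cmod v * v')) with
        ((Cmod v' * Cmod v') * dot v v + (Cmod v * Cmod v) * dot v' v' +
          2 * (Cmod v * Cmod v') * dot v v') by (unfold dot; simpl; ring).
      rewrite <- q1, <- q2. unfold s. ring. }
    rewrite <- Cmod_sqr in h.
    assert (0 <= Cmod v * Cmod v') by now apply Rmult_le_pos.
    generalize (Cmod_ge_0 (Cmod v' * v + Cmod v * v')). nra. }
  assert (en : RtoC (Cmod v + Cmod v') <> 0).
  { intros e. apply RtoC_inj in e. lra. }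
  unfold tri_int.
  rewrite (seg_split f w w' z0 (Cmod v / (Cmod v + Cmod v'))).
  + rewrite (seg_anti f z0 w), (seg_anti f z0 w') by auto. ring.
  + split; [apply Rdiv_le_0_compat; lra|]. apply Rle_div_l; lra.
  + rewrite ev, ev', RtoC_div by lra.
    replace (z0 + v + Cmod v / (Cmod v + Cmod v')%R * (z0 + v' - (z0 + v)))%C
      with (z0 + (Cmod v' * v + Cmod v * v') / (Cmod v + Cmod v')%R)%C.
    * rewrite ez. field. exact en.
    * rewrite RtoC_plus in *. field. exact en.
  + auto.
(* [u] bisects the angle at [z0], so it has a positive product with both sides [v] and [v']. *)
- set (u := (Cmod v' * v + Cmod v * v')%C).
  assert (d1 : dot u v = Cmod v * s).
  { unfold s, u. rewrite Rmult_plus_distr_l.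
    replace (Cmod v * (Cmod v * Cmod v')) with (Cmod v * Cmod v * Cmod v') by ring.
    rewrite Cmod_sqr. unfold dot; simpl; ring. }
  assert (d2 : dot u v' = Cmod v' * s).
  { unfold s, u. rewrite Rmult_plus_distr_l.
    replace (Cmod v' * (Cmod v * Cmod v')) with (Cmod v' * Cmod v' * Cmod v) by ring.
    rewrite Cmod_sqr. unfold dot; simpl; ring. }
  assert (hdot := dot_le_Cmod v v'). apply Rabs_le_between in hdot.
  assert (pv : 0 < Cmod v) by (unfold s in hs0; nra).
  assert (pv' : 0 < Cmod v') by (unfold s in hs0; nra).
  apply Cmod_small_eq_0. intros e he.
  destruct (hc z0 h0 1 Rlt_0_1) as [d0 [hd0 hb]].
  set (L := perimeter z0 w w').
  assert (hL : 0 <= L).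
  { unfold L, perimeter. generalize (Cmod_ge_0 (w - z0)) (Cmod_ge_0 (w' - w)) (Cmod_ge_0 (z0 - w')). lra. }
  (* Ratio of the small triangle at [z0]: at most 1 to keep its vertices on the sides, small against
     [d0] so that [f] differs from [f z0] by less than 1 on it, small against [e] so that its
     integral is at most [e]. *)
  set (eta := Rmin 1 (Rmin (d0 / (L + 1)) (e / (L + 1)))).
  assert (he0 : 0 < eta).
  { unfold eta. repeat apply Rmin_glb_lt; try lra; apply Rdiv_lt_0_compat; lra. }
  assert (he1 : eta <= 1) by apply Rmin_l.
  assert (he2 : eta * (L + 1) <= d0).
  { apply Rle_div_r; [lra|]. apply Rle_trans with (1 := Rmin_r _ _), Rmin_l. }
  assert (he3 : eta * (L + 1) <= e).
  { apply Rle_div_r; [lra|]. apply Rle_trans with (1 := Rmin_r _ _), Rmin_r. }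
  set (m := (z0 + RtoC eta * (w - z0))%C). set (m' := (z0 + RtoC eta * (w' - z0))%C).
  assert (hm : disk 1 m) by (apply disk_convex; auto; lra).
  assert (hm' : disk 1 m') by (apply disk_convex; auto; lra).
  set (r := Rmax (Cmod z0) (Rmax (Cmod w) (Cmod w'))).
  assert (r0 : Cmod z0 <= r) by apply Rmax_l.
  assert (r1 : Cmod w <= r) by (apply Rle_trans with (2 := Rmax_r _ _), Rmax_l).
  assert (r2 : Cmod w' <= r) by (apply Rle_trans with (2 := Rmax_r _ _), Rmax_r).
  assert (r3 : r < 1) by (repeat apply Rmax_lub_lt; assumption).
  set (d := eta * Rmin (dot u v) (dot u v')).
  assert (hdm : 0 < Rmin (dot u v) (dot u v')).
  { apply Rmin_glb_lt; rewrite ?d1, ?d2; now apply Rmult_lt_0_compat. }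
  assert (hd' : 0 < d) by now apply Rmult_lt_0_compat.
  set (K := fun x => Cmod x <= r /\ d <= dot u (x - z0)).
  assert (hK : forall p, K p -> cdiff f p).
  { intros p [k1 k2]. apply hd; [unfold disk; lra|]. intros ->.
    replace (z0 - z0)%C with (RtoC 0) in k2 by ring. unfold dot in k2. simpl in k2. lra. }
  assert (l1 := Rmin_l (dot u v) (dot u v')). assert (l2 := Rmin_r (dot u v) (dot u v')).
  assert (Kw : K w) by (split; [easy|fold v; unfold d; nra]).
  assert (Kw' : K w') by (split; [easy|fold v'; unfold d; nra]).
  assert (Km : K m).
  { split; [apply Cmod_line; trivial; lra|].
    replace (dot u (m - z0)) with (eta * dot u v) by (unfold m, dot; simpl; ring).
    unfold d; nra. }
  assert (Km' : K m').
  { split; [apply Cmod_line; trivial; lra|].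
    replace (dot u (m' - z0)) with (eta * dot u v') by (unfold m', dot; simpl; ring).
    unfold d; nra. }
  assert (g := fun a b c => goursat K f a b c (half_disk_convex r d u z0)
    (half_disk_closed r d u z0) hK).
  assert (g1 := g m w w' Km Kw Kw'). assert (g2 := g m w' m' Km Kw' Km').
  (* The quadrilateral left after cutting off the small triangle is divided by the diagonal from [m]
     to [w']. *)
  assert (eT : tri_int f z0 w w' = (tri_int f z0 m m' + tri_int f m w w' + tri_int f m w' m')%C).
  { unfold tri_int.
    rewrite (seg_split f z0 w m eta) by (auto; lra).
    rewrite (seg_anti f z0 w'), (seg_split f z0 w' m' eta) by (auto; lra).
    rewrite (seg_anti f m' w'), (seg_anti f z0 m'), (seg_anti f w' m), (seg_anti f m' m) by auto.
    ring. }
  rewrite eT, g1, g2, !Cplus_0_r.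
  assert (hper : perimeter z0 m m' = eta * L).
  { unfold perimeter, L, perimeter.
    replace (m - z0)%C with (RtoC eta * (w - z0))%C by (unfold m; ring).
    replace (m' - m)%C with (RtoC eta * (w' - w))%C by (unfold m, m'; ring).
    replace (z0 - m')%C with (RtoC eta * (z0 - w'))%C by (unfold m'; ring).
    rewrite !Cmod_mult, Cmod_R, Rabs_pos_eq by lra. ring. }
  assert (ht := tri_affine_approx f (f z0) 0 z0 m m' z0 0 1 (hs _ _ h0 hm) (hs _ _ hm hm')
    (hs _ _ hm' h0)).
  rewrite hper in ht. apply Rle_trans with (eta * L * 1); [apply ht|nra].
  + replace (z0 - z0)%C with (RtoC 0) by ring. rewrite Cmod_0. lra.
  + intros x hx. replace (f x - (f z0 + 0 * x))%C with (f x - f z0)%C by ring.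
    left. apply hb. nra.
Qed.

(** The vanishing integral around [z0], [z], [w] turns the increment of the primitive into the
    integral over the segment from [z] to [w], where continuity makes [f] almost constant. The base
    point is the exceptional one, so [tri_exceptional_vertex] suffices. *)
Lemma seg_primitive (f : C -> C) (z0 : C) :
  (forall p, disk 1 p -> ccont f p) ->
  (forall p, disk 1 p -> p <> z0 -> cdiff f p) -> disk 1 z0 ->
  forall z, disk 1 z -> forall eps, 0 < eps -> exists delta, 0 < delta /\
    forall w, Cmod (w - z) < delta ->
      Cmod (seg_int f z0 w - seg_int f z0 z - f z * (w - z)) <= eps * Cmod (w - z).
Proof.
intros hc hd h0 z hz e he.
destruct (hc z hz e he) as [d [hd0 hb]].
exists (Rmin d (1 - Cmod z)). split; [apply Rmin_glb_lt; unfold disk in hz; lra|].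
intros w hw.
assert (w1 := Rlt_le_trans _ _ _ hw (Rmin_l _ _)).
assert (w2 := Rlt_le_trans _ _ _ hw (Rmin_r _ _)).
assert (hw1 : disk 1 w) by (unfold disk; generalize (Cmod_sub_ge w z); lra).
assert (hs := fun x y => convex_cont_seg (disk 1) f x y (disk_convex 1) hc).
assert (t := tri_exceptional_vertex f z0 z w hc hd h0 hz hw1).
unfold tri_int in t. rewrite (seg_anti f z0 w) in t by auto.
replace (seg_int f z0 w - seg_int f z0 z)%C with (seg_int f z w)
  by (symmetry; apply Ceq_minus; rewrite <- Copp_0, <- t; ring).
assert (ha := seg_affine_approx f (f z) 0 z w e (hs _ _ hz hw1)).
rewrite Rmult_comm.
replace (f z * (w - z))%C with ((w - z) * (f z + 0 * (z + w) / RtoC 2))%C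
  by (field; exact RtoC_2_neq_0).
apply ha. intros s hs0 x. left.
replace (f x - (f z + 0 * x))%C with (f x - f z)%C by ring.
apply hb. unfold x. replace (z + s * (w - z) - z)%C with (s * (w - z))%C by ring.
rewrite Cmod_mult, Cmod_R, Rabs_pos_eq by lra.
generalize (Cmod_ge_0 (w - z)). nra.
Qed.

Definition circ (s t : R) : C := (s * cos t, s * sin t).

Lemma Cmod_circ (s t : R) : 0 <= s -> Cmod (circ s t) = s.
Proof.
intros hs. unfold Cmod, circ; simpl.
replace (s * cos t * (s * cos t * 1) + s * sin t * (s * sin t * 1))
  with (s * s * (Rsqr (sin t) + Rsqr (cos t))) by (unfold Rsqr; ring).
rewrite sin2_cos2, Rmult_1_r. now apply sqrt_square.
Qed.

Lemma circ_derive_bound (s t eps : R) : 0 < eps -> exists delta, 0 < delta /\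
  forall t', Rabs (t' - t) < delta ->
    Cmod (circ s t' - circ s t - RtoC (t' - t) * (Ci * circ s t)) <= eps * Rabs (t' - t).
Proof.
intros he.
assert (h1 : is_derive (fun t => s * cos t) t (- s * sin t)) by (auto_derive; [easy|ring]).
assert (h2 : is_derive (fun t => s * sin t) t (s * cos t)) by (auto_derive; [easy|ring]).
assert (he2 : 0 < eps / 2) by lra.
destruct (proj2 h1 t (fun P H => H) (mkposreal _ he2)) as [d1 k1].
destruct (proj2 h2 t (fun P H => H) (mkposreal _ he2)) as [d2 k2].
exists (Rmin d1 d2). split; [apply Rmin_glb_lt; apply cond_pos|].
intros t' ht.
specialize (k1 t' (Rlt_le_trans _ _ _ ht (Rmin_l _ _))).
specialize (k2 t' (Rlt_le_trans _ _ _ ht (Rmin_r _ _))).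
change (Rabs (s * cos t' - s * cos t - (t' - t) * (- s * sin t)) <= eps / 2 * Rabs (t' - t)) in k1.
change (Rabs (s * sin t' - s * sin t - (t' - t) * (s * cos t)) <= eps / 2 * Rabs (t' - t)) in k2.
set (x := s * cos t' - s * cos t - (t' - t) * (- s * sin t)) in k1.
set (y := s * sin t' - s * sin t - (t' - t) * (s * cos t)) in k2.
replace (circ s t' - circ s t - RtoC (t' - t) * (Ci * circ s t))%C with (RtoC x + Ci * RtoC y)%C
  by (unfold x, y; apply injective_projections; simpl; ring).
apply Rle_trans with (1 := Cmod_triangle _ _).
rewrite Cmod_mult, Cmod_Ci, !Cmod_R. lra.
Qed.

Lemma circ_continuous (s t : R) : continuous (T := R_UniformSpace) (U := CR) (circ s) t.
Proof.
apply (filterlim_locally (U := CR)). intros e.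
set (k := Cmod (Ci * circ s t)). assert (hk : 0 <= k) by apply Cmod_ge_0.
destruct (circ_derive_bound s t 1 Rlt_0_1) as [d [hd h]].
assert (hp : 0 < Rmin d (e / (1 + k))).
{ apply Rmin_glb_lt; [easy|apply Rdiv_lt_0_compat; [apply cond_pos|lra]]. }
exists (mkposreal _ hp). intros t' ht.
apply C_NormedModule_mixin_compat1.
assert (ht1 : Rabs (t' - t) < d) by (apply (Rlt_le_trans _ _ _ ht), Rmin_l).
assert (ht2 : Rabs (t' - t) < e / (1 + k)) by (apply (Rlt_le_trans _ _ _ ht), Rmin_r).
apply Rlt_div_r in ht2; [|lra].
specialize (h t' ht1).
generalize (Cmod_sub_ge (circ s t' - circ s t) (RtoC (t' - t) * (Ci * circ s t))).
rewrite (Cmod_mult (RtoC _)), Cmod_R. fold k.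
change (minus (circ s t') (circ s t)) with (circ s t' - circ s t)%C.
generalize (Rabs_pos (t' - t)). intros. nra.
Qed.

(** Since d zeta = i zeta dt, the integrand is, up to the factor i, the derivative of a primitive of
    [f] along the circle, and the end points agree. The bounds are left free because the kernel
    integral below runs backwards. *)
Lemma circ_integral_zero (f : C -> C) (z0 : C) (s a b : R) :
  (forall p, disk 1 p -> ccont f p) ->
  (forall p, disk 1 p -> p <> z0 -> cdiff f p) -> disk 1 z0 ->
  0 <= s < 1 -> circ s a = circ s b ->
  is_RInt (V := CR) (fun t => f (circ s t) * circ s t)%C a b (RtoC 0).
Proof.
intros hc hd h0 hs hab.
assert (hin : forall t, disk 1 (circ s t)) by (intros t; unfold disk; rewrite Cmod_circ; lra).
assert (hder : forall t, is_derive (K := R_AbsRing) (V := CR) (fun t => seg_int f z0 (circ s t)) t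
   (Ci * (f (circ s t) * circ s t))%C).
{ intros t. split; [apply is_linear_scal_l|].
  intros x hx.
  assert (ex : t = x)
    by exact (is_filter_lim_locally_unique (K := R_AbsRing) (V := AbsRing_NormedModule R_AbsRing) _ _ hx).
  subst x. intros e.
  set (l := f (circ s t)). set (k := Cmod (Ci * circ s t)).
  assert (hk : 0 <= k) by apply Cmod_ge_0. assert (hl := Cmod_ge_0 l).
  (* Chain rule by hand: [e1] controls the primitive on increments of size at most h (1 + k), [e2]
     the circle, whose error is multiplied by [Cmod l]. *)
  assert (e1 : 0 < e / (2 * (1 + k))) by (apply Rdiv_lt_0_compat; [apply cond_pos|lra]).
  assert (e2 : 0 < e / (2 * (1 + Cmod l))) by (apply Rdiv_lt_0_compat; [apply cond_pos|lra]).
  destruct (seg_primitive f z0 hc hd h0 _ (hin t) _ e1) as [d1 [hd1 k1]].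
  destruct (circ_derive_bound s t _ e2) as [d2 [hd2 k2]].
  destruct (circ_derive_bound s t 1 Rlt_0_1) as [d3 [hd3 k3]].
  assert (hp : 0 < Rmin (Rmin d2 d3) (d1 / (1 + k))).
  { repeat apply Rmin_glb_lt; trivial. apply Rdiv_lt_0_compat; lra. }
  exists (mkposreal _ hp). intros t' ht.
  assert (ht0 : Rabs (t' - t) < Rmin (Rmin d2 d3) (d1 / (1 + k))) by exact ht.
  assert (ht1 := Rlt_le_trans _ _ _ ht0 (Rmin_r _ _)).
  assert (ht' := Rlt_le_trans _ _ _ ht0 (Rmin_l _ _)).
  assert (ht2 := Rlt_le_trans _ _ _ ht' (Rmin_l _ _)).
  assert (ht3 := Rlt_le_trans _ _ _ ht' (Rmin_r _ _)).
  apply Rlt_div_r in ht1; [|lra].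
  specialize (k2 t' ht2). specialize (k3 t' ht3).
  set (h := Rabs (t' - t)) in *. assert (hh : 0 <= h) by apply Rabs_pos.
  assert (hinc : Cmod (circ s t' - circ s t) <= h * (1 + k)).
  { generalize (Cmod_sub_ge (circ s t' - circ s t) (RtoC (t' - t) * (Ci * circ s t))).
    rewrite (Cmod_mult (RtoC _)), Cmod_R. fold k h. lra. }
  specialize (k1 (circ s t') ltac:(lra)).
  rewrite scal_R_Cmult, <- Cmod_norm. fold l in k1 |- *.
  change (Cmod (seg_int f z0 (circ s t') - seg_int f z0 (circ s t)
            - RtoC (t' - t) * (Ci * (l * circ s t))) <= e * h).
  replace (seg_int f z0 (circ s t') - seg_int f z0 (circ s t) - RtoC (t' - t) * (Ci * (l * circ s t)))%C
    with ((seg_int f z0 (circ s t') - seg_int f z0 (circ s t) - l * (circ s t' - circ s t)) +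
      l * (circ s t' - circ s t - RtoC (t' - t) * (Ci * circ s t)))%C by ring.
  apply Rle_trans with (1 := Cmod_triangle _ _). rewrite Cmod_mult.
  apply Rle_trans with (e / (2 * (1 + k)) * (h * (1 + k)) + (1 + Cmod l) * (e / (2 * (1 + Cmod l)) * h)).
  - apply Rplus_le_compat.
    + apply Rle_trans with (1 := k1). apply Rmult_le_compat_l; lra.
    + apply Rmult_le_compat; try apply Cmod_ge_0; lra.
  - right. field. lra. }
assert (hcont : forall t, continuous (T := R_UniformSpace) (U := CR)
  (fun t => Ci * (f (circ s t) * circ s t))%C t).
{ intros t.
  apply (continuous_comp (U := R_UniformSpace) (V := CR) (W := CR) (circ s)
    (fun w => Ci * (f w * w))%C).
  - apply circ_continuous.
  - apply ccont_continuous, ccont_mult; [apply ccont_const|].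
    apply ccont_mult; [now apply hc|apply ccont_id]. }
assert (hI := is_RInt_derive (V := CR) _ _ a b (fun t _ => hder t) (fun t _ => hcont t)).
assert (hI' := is_RInt_Cmult (- Ci)%C _ _ _ _ hI).
cbv beta in hI'. rewrite <- hab, minus_eq_zero in hI'.
replace (RtoC 0) with (- Ci * RtoC 0)%C by ring.
apply (is_RInt_ext (V := CR)) with (2 := hI'). intros t _.
apply injective_projections; simpl; ring.
Qed.

(** * Cauchy's formula and the increments of bounded functions *)

Lemma circ_scale (s t : R) : circ s t = (RtoC s * circ 1 t)%C.
Proof. apply injective_projections; simpl; ring. Qed.

Lemma circ_1_opp (t : R) : circ 1 (- t) = (/ circ 1 t)%C.
Proof.
assert (h : (circ 1 (- t) * circ 1 t = 1)%C).
{ apply injective_projections; simpl; rewrite cos_neg, sin_neg.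
  - generalize (sin2_cos2 t). unfold Rsqr. lra.
  - ring. }
assert (n : circ 1 t <> 0) by (apply Cmod_neq_0; rewrite Cmod_circ; lra).
rewrite <- (Cmult_1_l (/ circ 1 t)), <- h. field. exact n.
Qed.

(* Under [zeta -> R^2 / conj zeta] the integrand [z / (zeta - z)] turns into a
   function of [conj zeta] that is analytic in the disk. *)
Lemma geometric_kernel_integral (z : C) (r : R) : Cmod z < r ->
  is_RInt (V := CR) (fun t => z / (circ r t - z))%C 0 (2 * PI) (RtoC 0).
Proof.
intros hz. assert (hz0 := Cmod_ge_0 z).
(* Any [s] strictly between |z|/r and 1 works: the pole of z/(s r - z w) is then outside the unit
   disk, and on the circle of radius [s] the parameter cancels. *)
set (s := (Cmod z / r + 1) / 2).
assert (hq : Cmod z / r < 1) by (apply Rlt_div_l; lra).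
assert (hq0 : 0 <= Cmod z / r) by (apply Rdiv_le_0_compat; lra).
assert (hs : 0 < s < 1) by (unfold s; lra).
assert (hzs : Cmod z < s * r) by (apply Rlt_div_l; unfold s; lra).
assert (hnz : forall w, disk 1 w -> (RtoC (s * r) - z * w)%C <> 0).
{ intros w hw. apply Cmod_neq_0.
  assert (h := Cmod_sub_ge (RtoC (s * r)) (z * w)). unfold disk in hw.
  rewrite Cmod_mult, Cmod_R, Rabs_pos_eq in h by nra.
  generalize (Cmod_ge_0 w). nra. }
assert (hd : forall p, disk 1 p -> cdiff (fun w => z / (RtoC (s * r) - z * w))%C p).
{ intros p hp.
  exists (fun w => (z * z) / ((RtoC (s * r) - z * w) * (RtoC (s * r) - z * p)))%C, (1 - Cmod p).
  split; [|split].
  - apply ccont_div; [apply ccont_const| |now apply Cmult_neq_0; apply hnz].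
    apply ccont_mult; [|apply ccont_const].
    apply ccont_minus; [apply ccont_const|].
    apply ccont_mult; [apply ccont_const|apply ccont_id].
  - unfold disk in hp; lra.
  - intros w hw. assert (hw1 : disk 1 w) by (unfold disk; generalize (Cmod_sub_ge w p); lra).
    field. split; now apply hnz. }
assert (h := circ_integral_zero (fun w => z / (RtoC (s * r) - z * w))%C 0 s (- 0) (- (2 * PI))
  (fun p hp => cdiff_ccont _ _ (hd p hp)) (fun p hp _ => hd p hp)).
assert (h' := is_RInt_comp_opp (V := CR) _ _ _ _
  (h ltac:(unfold disk; rewrite Cmod_0; lra) ltac:(lra)
     ltac:(unfold circ; rewrite !cos_neg, !sin_neg, cos_2PI, sin_2PI, cos_0, sin_0; reflexivity))).
assert (hm := is_RInt_Cmult (- (1))%C _ _ _ _ h').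
replace (RtoC 0) with (- (1) * RtoC 0)%C by ring.
apply (is_RInt_ext (V := CR)) with (2 := hm). intros t _.
change (opp (z / ((s * r)%R - z * circ s (- t)) * circ s (- t))%C)
  with (- (z / ((s * r)%R - z * circ s (- t)) * circ s (- t)))%C.
rewrite (circ_scale s), (circ_scale r), circ_1_opp.
assert (n : circ 1 t <> 0) by (apply Cmod_neq_0; rewrite Cmod_circ; lra).
assert (nr : (r * circ 1 t - z)%C <> 0).
{ apply Cmod_neq_0. generalize (Cmod_sub_ge (r * circ 1 t) z).
  rewrite <- circ_scale, Cmod_circ; lra. }
assert (ns : RtoC s <> 0) by (intros e; apply RtoC_inj in e; lra).
rewrite RtoC_mult. lazymatch goal with |- ?x = ?y => change (@eq C x y) end. field.
repeat split; trivial.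
replace (s * r * circ 1 t - z * s)%C with (s * (r * circ 1 t - z))%C by ring.
now apply Cmult_neq_0.
Qed.

Lemma analytic_slope (f : C -> C) (p : C) : analytic_on (disk 1) f -> disk 1 p ->
  exists phi : C -> C, ccont phi p /\ forall w, (f w - f p = phi w * (w - p))%C.
Proof.
intros hf hp. destruct (hf p hp) as [l hl].
destruct (is_derive_slope f p l hl) as [phi [h1 [_ h2]]]. now exists phi.
Qed.

Lemma analytic_cdiff (f : C -> C) (p : C) : analytic_on (disk 1) f -> disk 1 p -> cdiff f p.
Proof.
intros hf hp. destruct (analytic_slope f p hf hp) as [phi [h1 h2]].
exists phi, 1. split; [easy|split; [lra|auto]].
Qed.

Lemma circ_sub_neq_0 (r t : R) (z : C) : Cmod z < r -> (circ r t - z)%C <> 0.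
Proof.
intros h. apply Cmod_neq_0. generalize (Cmod_ge_0 z) (Cmod_sub_ge (circ r t) z).
intros h0. rewrite Cmod_circ; lra.
Qed.

(** With [g] the slope of [f] at [z], the integrand equals g(zeta) zeta + f(z) z/(zeta - z) + f(z).
    The first term integrates to zero with [z] as exceptional point, the second by
    [geometric_kernel_integral]. *)
Lemma cauchy_formula (f : C -> C) (z : C) (r : R) : analytic_on (disk 1) f ->
  Cmod z < r < 1 ->
  is_RInt (V := CR) (fun t => f (circ r t) * (circ r t / (circ r t - z)))%C 0 (2 * PI)
    (RtoC (2 * PI) * f z)%C.
Proof.
intros hf hr. assert (hz0 := Cmod_ge_0 z).
assert (hz : disk 1 z) by (unfold disk; lra).
destruct (analytic_slope f z hf hz) as [g [hg hgf]].
assert (hgd : forall p, disk 1 p -> p <> z -> cdiff g p).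
{ intros p hp hpz. destruct (analytic_slope f p hf hp) as [phi [hphi hpf]].
  assert (npz : (p - z)%C <> 0) by now apply Cminus_eq_contra.
  (* Slope of [g] at [p], obtained from the slope [phi] of [f] at [p] by the quotient rule; the
     radius keeps [w] away from [z]. *)
  exists (fun w => (phi w * (p - z) - (f p - f z)) / ((w - z) * (p - z)))%C, (Cmod (p - z)).
  split; [|split].
  - apply ccont_div; [| |now apply Cmult_neq_0].
    + apply ccont_minus; [apply ccont_mult; [easy|]|]; apply ccont_const.
    + apply ccont_mult; [|apply ccont_const].
      apply ccont_minus; [apply ccont_id|apply ccont_const].
  - now apply Cmod_gt_0.
  - intros w hw.
    assert (nwz : (w - z)%C <> 0).
    { apply Cmod_neq_0. generalize (Cmod_sub_triangle p w z). rewrite (Cmod_sub_sym p w). lra. }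
    replace (g w) with ((f w - f z) / (w - z))%C by (rewrite hgf; field; easy).
    replace (g p) with ((f p - f z) / (p - z))%C by (rewrite hgf; field; easy).
    replace (f w - f z)%C with (phi w * (w - p) + (f p - f z))%C by (rewrite <- hpf; ring).
    field. now split. }
assert (hgc : forall p, disk 1 p -> ccont g p).
{ intros p hp. destruct (Ceq_dec p z) as [->|n]; [easy|now apply cdiff_ccont, hgd]. }
assert (h1 := circ_integral_zero g z r 0 (2 * PI) hgc hgd hz ltac:(lra)
  ltac:(unfold circ; rewrite cos_2PI, sin_2PI, cos_0, sin_0; reflexivity)).
assert (h2 := is_RInt_Cmult (f z) _ _ _ _ (geometric_kernel_integral z r (proj1 hr))).
assert (h3 := is_RInt_const (V := CR) 0 (2 * PI) (f z)).
assert (h := is_RInt_plus (V := CR) _ _ _ _ _ _ (is_RInt_plus (V := CR) _ _ _ _ _ _ h1 h2) h3).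
replace (RtoC (2 * PI) * f z)%C with
  (plus (G := CR) (plus (G := CR) (RtoC 0) (f z * RtoC 0)%C) (scal (V := CR) (2 * PI - 0) (f z))).
- apply (is_RInt_ext (V := CR)) with (2 := h). intros t _.
  assert (n := circ_sub_neq_0 r t z (proj1 hr)).
  change ((g (circ r t) * circ r t + f z * (z / (circ r t - z)) + f z)%C
    = (f (circ r t) * (circ r t / (circ r t - z)))%C).
  replace (f (circ r t)) with (f z + g (circ r t) * (circ r t - z))%C by (rewrite <- hgf; ring).
  field. exact n.
- rewrite scal_R_Cmult, Rminus_0_r.
  change (0 + f z * 0 + (2 * PI)%R * f z = (2 * PI)%R * f z)%C. ring.
Qed.

(** Integrals are kept in the form 2 PI times a mean, a form preserved by [is_RInt_sub] and
    [is_RInt_mul], so a pointwise bound of the kernel passes directly to the mean. *)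
Lemma mean_bound (h : R -> C) (x : C) (b : R) :
  is_RInt (V := CR) h 0 (2 * PI) (RtoC (2 * PI) * x)%C ->
  (forall t, Cmod (h t) <= b) -> Cmod x <= b.
Proof.
intros hh hb. assert (hpi := PI_RGT_0).
assert (hn := norm_RInt_le_const (V := CR) h 0 (2 * PI) _ b ltac:(lra)
  (fun t _ => eq_ind _ (fun u => u <= b) (hb t) _ (Cmod_norm _)) hh).
rewrite <- Cmod_norm, Cmod_mult, Cmod_R, Rabs_pos_eq in hn by lra.
apply Rmult_le_reg_l with (2 * PI); lra.
Qed.

Lemma is_RInt_sub (f g : R -> C) (a b : R) (k x y : C) :
  is_RInt (V := CR) f a b (k * x)%C -> is_RInt (V := CR) g a b (k * y)%C ->
  is_RInt (V := CR) (fun t => f t - g t)%C a b (k * (x - y))%C.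
Proof.
intros hf hg. replace (k * (x - y))%C with (k * x - k * y)%C by ring.
exact (is_RInt_minus (V := CR) _ _ _ _ _ _ hf hg).
Qed.

Lemma is_RInt_mul (f : R -> C) (a b : R) (k x c : C) :
  is_RInt (V := CR) f a b (k * x)%C ->
  is_RInt (V := CR) (fun t => c * f t)%C a b (k * (c * x))%C.
Proof.
intros hf. replace (k * (c * x))%C with (c * (k * x))%C by ring. now apply is_RInt_Cmult.
Qed.

(** Subtracting the formula at 0 replaces the kernel zeta/(zeta - z) by zeta/(zeta - z) - 1 =
    z/(zeta - z). *)
Lemma cauchy_formula_0 (f : C -> C) (z : C) (r : R) : analytic_on (disk 1) f ->
  f 0 = 0 -> Cmod z < r < 1 ->
  is_RInt (V := CR) (fun t => f (circ r t) * (z / (circ r t - z)))%C 0 (2 * PI)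
    (RtoC (2 * PI) * f z)%C.
Proof.
intros hf f0 hr. assert (hz0 := Cmod_ge_0 z).
assert (h0 : Cmod 0 < r < 1) by (rewrite Cmod_0; lra).
assert (h := is_RInt_sub _ _ _ _ _ _ _ (cauchy_formula f z r hf hr) (cauchy_formula f 0 r hf h0)).
replace (RtoC (2 * PI) * f z)%C with (RtoC (2 * PI) * (f z - f 0))%C by (rewrite f0; ring).
apply (is_RInt_ext (V := CR)) with (2 := h). intros t _. cbv beta.
assert (n := circ_sub_neq_0 r t z (proj1 hr)).
assert (n0 : circ r t <> 0) by (apply Cmod_neq_0; rewrite Cmod_circ; lra).
lazymatch goal with |- ?x = ?y => change (@eq C x y) end. field. now split.
Qed.

(** Instead of differentiating under the integral, the mean [J] of f(zeta)/zeta is compared with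
    f(x)/x, the mean of f(zeta)/(zeta - x), at one small real [x]; that quotient is also close to
    [l]. *)
Lemma cauchy_derivative_0 (f : C -> C) (l : C) (M r : R) : analytic_on (disk 1) f ->
  (forall z, disk 1 z -> Cmod (f z) <= M) -> f 0 = 0 ->
  is_derive (K := C_AbsRing) (V := C_NormedModule) f (RtoC 0) l -> 0 < r < 1 ->
  is_RInt (V := CR) (fun t => f (circ r t) * / circ r t)%C 0 (2 * PI)
    (RtoC (2 * PI) * l)%C.
Proof.
intros hf hM f0 hl hr.
assert (hpi := PI_RGT_0).
assert (hin : forall t, disk 1 (circ r t)) by (intros t; unfold disk; rewrite Cmod_circ; lra).
assert (hne : forall t, circ r t <> 0) by (intros t; apply Cmod_neq_0; rewrite Cmod_circ; lra).
assert (npi : RtoC (2 * PI) <> 0) by (intros e; apply RtoC_inj in e; lra).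
assert (hI : exists J, is_RInt (V := CR) (fun t => f (circ r t) * / circ r t)%C 0 (2 * PI)
    (RtoC (2 * PI) * J)%C).
{ destruct (ex_RInt_continuous (V := CR) (fun t => f (circ r t) * / circ r t)%C 0 (2 * PI)) as [I hI].
  - intros t _. apply (continuous_comp (U := R_UniformSpace) (V := CR) (W := CR) (circ r)
      (fun w => f w * / w)%C).
    + apply circ_continuous.
    + apply ccont_continuous, ccont_mult.
      * now apply cdiff_ccont, analytic_cdiff.
      * apply ccont_inv; [apply ccont_id|easy].
  - exists (/ RtoC (2 * PI) * I)%C.
    assert (hk : forall x : C, (RtoC (2 * PI) * (/ RtoC (2 * PI) * x))%C = x)
      by (intros x; now field).
    rewrite hk. exact hI. }
destruct hI as [J hJ].
destruct (is_derive_slope f 0 l hl) as [phi [hphi [phi0 hs]]].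
replace l with J; [exact hJ|]. apply Ceq_minus, Cmod_small_eq_0. intros e he.
destruct (hphi (e / 2)) as [d [hd hd']]; [lra|].
assert (M0 : 0 <= M) by (apply Rle_trans with (2 := hM _ (hin 0)), Cmod_ge_0).
(* For [x <= r / 2] the two kernels differ by at most x / (r^2 / 2), so [x <= k] brings [J] within
   e/2 of f(x)/x. *)
set (k := e / 2 * (r * r / 2) / (M + 1)).
assert (hk : 0 < k) by (unfold k; repeat (apply Rmult_lt_0_compat || apply Rinv_0_lt_compat); lra).
assert (hkM : k * (M + 1) = e / 2 * (r * r / 2)) by (unfold k; field; lra).
set (x := Rmin (d / 2) (Rmin (r / 2) k)).
assert (hx0 : 0 < x) by (repeat apply Rmin_glb_lt; lra).
assert (hx1 : x <= d / 2) by apply Rmin_l.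
assert (hx2 : x <= r / 2) by (apply Rle_trans with (1 := Rmin_r _ _), Rmin_l).
assert (hx3 : x <= k) by (apply Rle_trans with (1 := Rmin_r _ _), Rmin_r).
assert (cx : Cmod x = x) by (rewrite Cmod_R; apply Rabs_pos_eq; lra).
assert (nx : RtoC x <> 0) by (apply Cmod_neq_0; lra).
assert (hphix : phi x = (f x / x)%C).
{ assert (h := hs x). rewrite f0 in h. replace (f x) with (f x - 0)%C by ring.
  rewrite h. field. exact nx. }
assert (hxr : Cmod x < r < 1) by lra.
assert (h := is_RInt_sub _ _ _ _ _ _ _ hJ
  (is_RInt_mul _ _ _ _ _ (/ x)%C (cauchy_formula_0 f x r hf f0 hxr))).
assert (hJx : Cmod (J - / x * f x) <= e / 2).
{ apply (mean_bound _ _ _ h). intros t.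
  assert (n := circ_sub_neq_0 r t x (proj1 hxr)).
  replace (f (circ r t) * / circ r t - / x * (f (circ r t) * (x / (circ r t - x))))%C
    with (f (circ r t) * (- x / (circ r t * (circ r t - x))))%C
    by (field; repeat split; trivial).
  rewrite Cmod_mult, Cmod_div by now apply Cmult_neq_0.
  rewrite Cmod_mult, Cmod_opp, cx, Cmod_circ by lra.
  assert (hh := Cmod_sub_ge (circ r t) x). rewrite cx, Cmod_circ in hh by lra.
  assert (hm := hM _ (hin t)).
  apply Rle_trans with (M * (x / (r * (r / 2)))).
  - apply Rmult_le_compat; [apply Cmod_ge_0| |easy|].
    + apply Rdiv_le_0_compat; [lra|]. apply Rmult_lt_0_compat; lra.
    + apply Rmult_le_compat_l; [lra|]. apply Rinv_le_contravar; nra.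
  - apply Rle_trans with (M * x / (r * r / 2)); [right; field; lra|].
    apply Rle_div_l; nra. }
apply Rle_trans with (1 := Cmod_sub_triangle _ (phi x) _).
assert (h2 : Cmod (phi x - l) < e / 2).
{ rewrite <- phi0. apply hd'. replace (x - 0)%C with (RtoC x) by ring. rewrite cx. lra. }
rewrite hphix in *.
replace (f x / x)%C with (/ x * f x)%C in * by (field; exact nx). lra.
Qed.

Lemma limit_at_1_le (phi : R -> R) (x r : R) : r < 1 -> ex_derive phi 1 ->
  (forall s, r < s < 1 -> x <= phi s) -> x <= phi 1.
Proof.
intros hr hd h. apply le_epsilon. intros e he.
assert (hc := ex_derive_continuous (K := R_AbsRing) (V := R_NormedModule) phi 1 hd).
destruct (proj1 (filterlim_locally (U := R_NormedModule) phi (phi 1)) hc (mkposreal e he))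
  as [d hd'].
assert (hdp := cond_pos d).
set (s := Rmax ((1 + r) / 2) (1 - d / 2)).
assert (s1 : (1 + r) / 2 <= s) by apply Rmax_l. assert (s2 : 1 - d / 2 <= s) by apply Rmax_r.
assert (s3 : s < 1) by (apply Rmax_lub_lt; lra).
assert (hb : Rabs (phi s - phi 1) < e).
{ apply hd'. change (Rabs (s - 1) < d). apply Rabs_def1; lra. }
apply Rabs_def2 in hb. specialize (h s ltac:(lra)). lra.
Qed.

(** The combined kernel z1/(zeta - z1) - z2/(zeta - z2) - (z1 - z2)/zeta has the factor [z1 - z2].
    Two radii are kept so that [z2 = 0], [r2 = 0] yields the growth bound M r^2/(1 - r) for f(z) -
    z. *)
Lemma increment_bound (f : C -> C) (M r1 r2 : R) (z1 z2 : C) :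
  analytic_on (disk 1) f -> (forall z, disk 1 z -> Cmod (f z) <= M) -> f 0 = 0 ->
  is_derive (K := C_AbsRing) (V := C_NormedModule) f (RtoC 0) (RtoC 1) ->
  Cmod z1 <= r1 -> Cmod z2 <= r2 -> r2 <= r1 < 1 ->
  Cmod (f z1 - f z2 - (z1 - z2)) <=
    M * (Cmod (z1 - z2) * (r2 / (1 - r1) ^ 2 + r1 / (1 - r1))).
Proof.
intros hf hM f0 f1 h1 h2 hr.
assert (p1 := Cmod_ge_0 z1). assert (p2 := Cmod_ge_0 z2). assert (p12 := Cmod_ge_0 (z1 - z2)).
set (phi := fun s => M * (Cmod (z1 - z2) * (r2 / (s - r1) ^ 2 + r1 / (s * (s - r1))))).
replace (M * (Cmod (z1 - z2) * (r2 / (1 - r1) ^ 2 + r1 / (1 - r1)))) with (phi 1)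
  by (unfold phi; field; lra).
apply (limit_at_1_le phi _ r1); [lra| |].
{ unfold phi. auto_derive. repeat split; trivial; apply Rgt_not_eq; nra. }
intros s hs. unfold phi.
assert (k1 : Cmod z1 < s < 1) by lra. assert (k2 : Cmod z2 < s < 1) by lra.
assert (hI := is_RInt_sub _ _ _ _ _ _ _
  (is_RInt_sub _ _ _ _ _ _ _ (cauchy_formula_0 f z1 s hf f0 k1) (cauchy_formula_0 f z2 s hf f0 k2))
  (is_RInt_mul _ _ _ _ _ (z1 - z2)%C (cauchy_derivative_0 f 1 M s hf hM f0 f1 ltac:(lra)))).
rewrite Cmult_1_r in hI.
apply (mean_bound _ _ _ hI). intros t.
assert (n1 := circ_sub_neq_0 s t z1 (proj1 k1)).
assert (n2 := circ_sub_neq_0 s t z2 (proj1 k2)).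
assert (n0 : circ s t <> 0) by (apply Cmod_neq_0; rewrite Cmod_circ; lra).
set (ze := circ s t) in *.
assert (cze : Cmod ze = s) by (apply Cmod_circ; lra).
replace (f ze * (z1 / (ze - z1)) - f ze * (z2 / (ze - z2)) - (z1 - z2) * (f ze * / ze))%C
  with (f ze * ((z1 - z2) * (z2 / ((ze - z1) * (ze - z2)) + z1 / (ze * (ze - z1)))))%C
  by (field; repeat split; trivial).
assert (d1 := Cmod_sub_ge ze z1). assert (d2 := Cmod_sub_ge ze z2).
rewrite cze in d1, d2.
rewrite 2!Cmod_mult.
apply Rmult_le_compat; [apply Cmod_ge_0| |apply hM; unfold disk; lra|].
{ apply Rmult_le_pos; apply Cmod_ge_0. }
apply Rmult_le_compat_l; [easy|].
apply Rle_trans with (1 := Cmod_triangle _ _).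
rewrite !Cmod_div, !Cmod_mult, cze by now apply Cmult_neq_0.
apply Rplus_le_compat; unfold Rdiv; apply Rmult_le_compat; try lra;
  try (left; apply Rinv_0_lt_compat; nra); apply Rinv_le_contravar; nra.
Qed.

(** Product rule for the kernels: the increment of [conj z] multiplies the kernel at [z1], and
    [conj z2] multiplies the increment of the kernel. *)
Lemma conj_increment_bound (f : C -> C) (M r : R) (z1 z2 : C) :
  analytic_on (disk 1) f -> (forall z, disk 1 z -> Cmod (f z) <= M) -> f 0 = 0 ->
  Cmod z1 <= r -> Cmod z2 <= r -> r < 1 ->
  Cmod (Cconj z1 * f z1 - Cconj z2 * f z2) <=
    M * (Cmod (z1 - z2) * (r / (1 - r) + r / (1 - r) ^ 2)).
Proof.
intros hf hM f0 h1 h2 hr.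
assert (p1 := Cmod_ge_0 z1). assert (p2 := Cmod_ge_0 z2). assert (p12 := Cmod_ge_0 (z1 - z2)).
set (phi := fun s => M * (Cmod (z1 - z2) * (r / (s - r) + r * s / (s - r) ^ 2))).
replace (M * (Cmod (z1 - z2) * (r / (1 - r) + r / (1 - r) ^ 2))) with (phi 1)
  by (unfold phi; field; lra).
apply (limit_at_1_le phi _ r); [lra| |].
{ unfold phi. auto_derive. repeat split; trivial; apply Rgt_not_eq; nra. }
intros s hs. unfold phi.
assert (k1 : Cmod z1 < s < 1) by lra. assert (k2 : Cmod z2 < s < 1) by lra.
assert (hI := is_RInt_sub _ _ _ _ _ _ _
  (is_RInt_mul _ _ _ _ _ (Cconj z1) (cauchy_formula_0 f z1 s hf f0 k1))
  (is_RInt_mul _ _ _ _ _ (Cconj z2) (cauchy_formula_0 f z2 s hf f0 k2))).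
apply (mean_bound _ _ _ hI). intros t.
assert (n1 := circ_sub_neq_0 s t z1 (proj1 k1)).
assert (n2 := circ_sub_neq_0 s t z2 (proj1 k2)).
set (ze := circ s t) in *.
assert (cze : Cmod ze = s) by (apply Cmod_circ; lra).
replace (Cconj z1 * (f ze * (z1 / (ze - z1))) - Cconj z2 * (f ze * (z2 / (ze - z2))))%C
  with (f ze * (Cconj (z1 - z2) * (z1 / (ze - z1)) +
     (z1 - z2) * (Cconj z2 * ze / ((ze - z1) * (ze - z2)))))%C
  by (rewrite Cminus_conj; field; repeat split; trivial).
assert (d1 := Cmod_sub_ge ze z1). assert (d2 := Cmod_sub_ge ze z2).
rewrite cze in d1, d2.
rewrite Cmod_mult.
apply Rmult_le_compat; [apply Cmod_ge_0|apply Cmod_ge_0|apply hM; unfold disk; lra|].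
apply Rle_trans with (1 := Cmod_triangle _ _).
rewrite Rmult_plus_distr_l, !(Cmod_mult _ (_ / _)), Cmod_conj.
rewrite !Cmod_div, !Cmod_mult, Cmod_conj, cze by (trivial; now apply Cmult_neq_0).
apply Rplus_le_compat; apply Rmult_le_compat_l; trivial;
  unfold Rdiv; apply Rmult_le_compat; try nra;
  try (left; apply Rinv_0_lt_compat; nra); apply Rinv_le_contravar; nra.
Qed.

(** * The fixed point argument *)

(** Banach iteration of w - G z from [w]; the condition [Cmod w + g <= r] keeps it in the closed
    disk. *)
Lemma contraction_perturbation_solvable (G : C -> C) (w : C) (r k g : R) : 0 <= k < 1 ->
  (forall z, Cmod z <= r -> Cmod (G z) <= g) ->
  (forall z1 z2, Cmod z1 <= r -> Cmod z2 <= r ->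
     Cmod (G z1 - G z2) <= k * Cmod (z1 - z2)) ->
  0 <= g -> Cmod w + g <= r -> exists z, Cmod z <= r /\ (z + G z = w)%C.
Proof.
intros hk hg hG g0 hw.
set (u := fun n => Nat.iter n (fun z => w - G z)%C w).
assert (hu : forall n, Cmod (u n) <= r).
{ induction n as [|n IH]; [simpl; lra|].
  change (u (S n)) with (w - G (u n))%C.
  apply Rle_trans with (1 := Cmod_triangle _ _). rewrite Cmod_opp.
  specialize (hg _ IH). lra. }
assert (hinc : forall n, Cmod (u (S n) - u n) <= Cmod (u 1%nat - u 0%nat) * k ^ n).
{ induction n as [|n IH]; [simpl pow; lra|].
  replace (u (S (S n)) - u (S n))%C with (G (u n) - G (u (S n)))%C.
  - specialize (hG (u n) (u (S n)) (hu _) (hu _)). rewrite Cmod_sub_sym in IH.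
    simpl pow. nra.
  - change (G (u n) - G (u (S n)) = w - G (u (S n)) - (w - G (u n)))%C. ring. }
destruct (geometric_increments_limit u _ k hk hinc) as [l hl].
set (c := Cmod (u 1%nat - u 0%nat)) in *. assert (hc : 0 <= c) by apply Cmod_ge_0.
(* Two consecutive terms are needed, as the residual at [l] is l - u(n+1) plus G l - G(u n). *)
assert (hsmall : forall e, 0 < e -> exists n, Cmod (u n - l) <= e /\ Cmod (u (S n) - l) <= e).
{ intros e he.
  destruct (pow_lt_1_zero k ltac:(rewrite Rabs_pos_eq; lra) (e * (1 - k) / (c + 1))) as [N hN].
  { apply Rdiv_lt_0_compat; [|lra]. apply Rmult_lt_0_compat; lra. }
  assert (hb : forall n, (n >= N)%nat -> Cmod (u n - l) <= e).
  { intros n hn. apply Rle_trans with (1 := hl n). specialize (hN n hn).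
    assert (hp : 0 <= k ^ n) by (apply pow_le; lra).
    rewrite Rabs_pos_eq in hN by easy. apply Rlt_div_r in hN; [|lra].
    apply Rle_div_l; [lra|]. nra. }
  exists N. split; apply hb; lia. }
assert (hlr : Cmod l <= r).
{ apply le_epsilon. intros e he. destruct (hsmall e he) as [n [h1 _]].
  generalize (Cmod_sub_ge l (u n)) (hu n). rewrite Cmod_sub_sym. lra. }
exists l. split; [easy|]. apply Ceq_minus, Cmod_small_eq_0. intros e he.
destruct (hsmall (e / 2)) as [n [h1 h2]]; [lra|].
replace (l + G l - w)%C with ((l - u (S n)) + (G l - G (u n)))%C
  by (change (u (S n)) with (w - G (u n))%C; ring).
apply Rle_trans with (1 := Cmod_triangle _ _).
specialize (hG l (u n) hlr (hu n)). rewrite Cmod_sub_sym in h1, h2.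
generalize (Cmod_ge_0 (l - u n)). intros. nra.
Qed.

(** * Choice of the radius, univalence and the covered disk *)

Theorem corollary1 (M : R) (F A B : C -> C)
  (hM : 0 < M)
  (hA : analytic_on (disk 1) A)
  (hB : analytic_on (disk 1) B)
  (hF : forall z : C, disk 1 z -> F z = (Cconj z * A z + B z)%C)
  (hA0 : A (RtoC 0) = RtoC 0)
  (hB0 : B (RtoC 0) = RtoC 0)
  (hA1 : is_derive (K := C_AbsRing) (V := C_NormedModule) A (RtoC 0) (RtoC 1))
  (hB1 : is_derive (K := C_AbsRing) (V := C_NormedModule) B (RtoC 0) (RtoC 1))
  (hAM : forall z : C, disk 1 z -> Cmod (A z) <= M)
  (hBM : forall z : C, disk 1 z -> Cmod (B z) <= M) :
  exists rho1 : R,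
    0 < rho1 < 1 /\
    univalent_on (disk rho1) F /\
    1 - 2 * M * ((2 * rho1 - rho1 ^ 2) / (1 - rho1) ^ 2) = 0 /\
    rho1 = 2 * M / (2 * M + 1)
           * (1 - sqrt ((2 * M + 1) / (2 * M)) + 1 / (2 * M)) /\
    let R1 := rho1 - rho1 ^ 2 - M * ((rho1 ^ 3 + rho1 ^ 2) / (1 - rho1)) in
    forall w : C, disk R1 w -> image F (disk rho1) w.
Proof.
(* The stated radius simplifies to 1 - 1/a. With [q] = 1/a = 1 - rho its equation reads q^2 (2 M +
   1) = 2 M. *)
set (a := sqrt ((2 * M + 1) / (2 * M))).
set (rho := 2 * M / (2 * M + 1) * (1 - a + 1 / (2 * M))).
assert (ha2 : a * a = (2 * M + 1) / (2 * M)).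
{ apply sqrt_sqrt. apply Rdiv_le_0_compat; lra. }
assert (ha0 : 0 <= a) by apply sqrt_pos.
assert (haM : a * a * (2 * M) = 2 * M + 1) by (rewrite ha2; field; lra).
assert (ha1 : 1 < a).
{ apply Rnot_le_lt. intros h. assert (a * a <= 1) by nra. nra. }
assert (hrho : rho = 1 - / a).
{ unfold rho. replace (2 * M / (2 * M + 1)) with (/ (a * a)) by (rewrite ha2; field; lra).
  replace (1 / (2 * M)) with (a * a - 1) by (rewrite ha2; field; lra). field; lra. }
assert (hia : 0 < / a < 1).
{ split; [apply Rinv_0_lt_compat; lra|]. rewrite <- Rinv_1. apply Rinv_lt_contravar; lra. }
assert (hqM : / a * / a * (2 * M + 1) = 2 * M) by (rewrite <- haM; field; lra).
set (q := / a) in *.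
assert (hr : 0 < rho < 1) by lra.
(* [k r] is the Lipschitz constant and [g r] the size of F z - z on |z| <= r; [R1] is rho - g
   rho. *)
set (k := fun r => 2 * M * ((2 * r - r ^ 2) / (1 - r) ^ 2)).
set (g := fun r => r ^ 2 + M * ((r ^ 3 + r ^ 2) / (1 - r))).
assert (hlip : forall r z1 z2, r < 1 -> Cmod z1 <= r -> Cmod z2 <= r ->
  Cmod ((F z1 - z1) - (F z2 - z2)) <= k r * Cmod (z1 - z2)).
{ intros r z1 z2 h h1 h2. rewrite !hF by (unfold disk; lra).
  replace (Cconj z1 * A z1 + B z1 - z1 - (Cconj z2 * A z2 + B z2 - z2))%C with
    ((Cconj z1 * A z1 - Cconj z2 * A z2) + (B z1 - B z2 - (z1 - z2)))%C by ring.
  apply Rle_trans with (1 := Cmod_triangle _ _).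
  assert (b1 := conj_increment_bound A M r z1 z2 hA hAM hA0 h1 h2 h).
  assert (b2 := increment_bound B M r r z1 z2 hB hBM hB0 hB1 h1 h2 ltac:(lra)).
  apply Rle_trans with (1 := Rplus_le_compat _ _ _ _ b1 b2).
  right. unfold k. field. lra. }
assert (hgrow : forall r z, r < 1 -> Cmod z <= r -> Cmod (F z - z) <= g r).
{ intros r z h hz. assert (hz0 := Cmod_ge_0 z). rewrite hF by (unfold disk; lra).
  assert (b : forall f : C -> C, analytic_on (disk 1) f ->
    (forall z : C, disk 1 z -> Cmod (f z) <= M) -> f 0 = 0 ->
    is_derive (K := C_AbsRing) (V := C_NormedModule) f (RtoC 0) (RtoC 1) ->
    Cmod (f z - z) <= M * (r * (r / (1 - r)))).
  { intros f f1 f2 f3 f4.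
    assert (b := increment_bound f M r 0 z 0 f1 f2 f3 f4 hz ltac:(rewrite Cmod_0; lra) ltac:(lra)).
    rewrite f3 in b.
    replace (f z - 0 - (z - 0))%C with (f z - z)%C in b by ring.
    replace (z - 0)%C with z in b by ring.
    apply Rle_trans with (1 := b). apply Rmult_le_compat_l; [lra|].
    unfold Rdiv at 1. rewrite Rmult_0_l, Rplus_0_l.
    apply Rmult_le_compat_r; [apply Rdiv_le_0_compat; lra|easy]. }
  assert (bA := b A hA hAM hA0 hA1). assert (bB := b B hB hBM hB0 hB1).
  replace (Cconj z * A z + B z - z)%C with (Cconj z * A z + (B z - z))%C by ring.
  apply Rle_trans with (1 := Cmod_triangle _ _). rewrite Cmod_mult, Cmod_conj.
  assert (hAz : Cmod (A z) <= r + M * (r * (r / (1 - r)))).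
  { generalize (Cmod_le_plus (A z) z). lra. }
  replace (g r) with (r * (r + M * (r * (r / (1 - r)))) + M * (r * (r / (1 - r))))
    by (unfold g; field; lra).
  apply Rplus_le_compat; [|easy].
  apply Rmult_le_compat; trivial; apply Cmod_ge_0. }
assert (hk : forall r, 0 <= r < rho -> 0 <= k r < 1).
{ intros r h. unfold k. assert (h1 : 0 < (1 - r) ^ 2) by (apply pow_lt; lra).
  split.
  - apply Rmult_le_pos; [lra|]. apply Rdiv_le_0_compat; nra.
  - replace (2 * M * ((2 * r - r ^ 2) / (1 - r) ^ 2)) with
      (2 * M * (2 * r - r ^ 2) / (1 - r) ^ 2) by (field; lra).
    apply Rlt_div_l; [easy|].
    assert (q * q < (1 - r) ^ 2) by (simpl; nra). nra. }
exists rho. split; [easy|split; [|split; [|split; [reflexivity|]]]].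
- intros z1 z2 h1 h2 e. unfold disk in h1, h2.
  (* The larger modulus is still below [rho], so [k r < 1] although [k rho = 1]. *)
  set (r := Rmax (Cmod z1) (Cmod z2)).
  assert (hr0 : r < rho) by now apply Rmax_lub_lt.
  assert (hr1 : Cmod z1 <= r) by apply Rmax_l. assert (hr2 : Cmod z2 <= r) by apply Rmax_r.
  assert (hl := hlip r z1 z2 ltac:(lra) hr1 hr2).
  rewrite e in hl. replace (F z2 - z1 - (F z2 - z2))%C with (z2 - z1)%C in hl by ring.
  rewrite Cmod_sub_sym in hl.
  assert (hkr := hk r ltac:(generalize (Cmod_ge_0 z1); lra)).
  apply Ceq_minus, Cmod_eq_0. generalize (Cmod_ge_0 (z1 - z2)). nra.
- rewrite hrho. replace (1 - (1 - q)) with q by ring.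
  replace (2 * (1 - q) - (1 - q) ^ 2) with (1 - q * q) by ring.
  replace (2 * M * ((1 - q * q) / q ^ 2)) with ((2 * M - q * q * (2 * M)) / (q * q)) by (field; lra).
  replace (2 * M - q * q * (2 * M)) with (q * q) by lra. field; lra.
- intros R1 w hw. unfold disk in hw.
  assert (hgrho : R1 = rho - g rho) by (unfold R1, g; ring).
  assert (hg0 : 0 <= g rho).
  { apply Rle_trans with (2 := hgrow rho 0 ltac:(lra) ltac:(rewrite Cmod_0; lra)), Cmod_ge_0. }
  (* The smallest radius the iteration allows when F z - z is bounded by [g rho]; [Cmod w < R1] says
     exactly that it is below [rho]. *)
  set (r := Cmod w + g rho).
  assert (hr1 : 0 <= r < rho) by (generalize (Cmod_ge_0 w); unfold r; lra).
  destruct (contraction_perturbation_solvable (fun z => F z - z)%C w r (k r) (g rho))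
    as [z [hz ez]]; trivial.
  + now apply hk.
  + intros z hz. apply hgrow; lra.
  + intros z1 z2 h1 h2. apply hlip; trivial; lra.
  + unfold r; lra.
  + exists z. split; [unfold disk; lra|]. rewrite <- ez. ring.
Qed.
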